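(* Define integers $C_{1^93^{-5}}(n)$ for $n\ge 0$ by $$\frac{(q;q)_\infty^9}{(q^3;q^3)_\infty^5}=\sum_{n\ge0}C_{1^93^{-5}}(n)q^n ,$$ and let $s_{1^93^{-5}}(n):=\operatorname{sgn}(C_{1^93^{-5}}(n))$. Then for all integers $n\ge0$ $$s_{1^93^{-5}}(n)=\begin{cases}1&\text{if }n\equiv 0,2,5,6,8\pmod 9,\\ -1&\text{if }n\equiv 1,3,4,7\pmod 9.\end{cases}$$
   Context: $(a;q)_\infty:=\prod_{j=0}^{\infty}(1-aq^j)$ is the $q$-Pochhammer symbol; $\operatorname{sgn}(x)\in\{-1,0,1\}$ is the sign of the real number $x$, with $\operatorname{sgn}(0)=0$. *)

(* Defs.v *)
From HB Require Import structures.
From mathcomp Require Import all_boot all_order all_algebra.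
From mathcomp Require Import boolp classical_sets.

Set Implicit Arguments.
Unset Strict Implicit.
Unset Printing Implicit Defensive.

Import GRing.Theory.
Local Open Scope ring_scope.

(* The ring R[[X]] of formal power series, with the Cauchy product. A series  *)
(* coerces to its coefficient function: [f n] is the coefficient of X^n.      *)
(* The wrapper keeps the pointwise structures of [nat -> R] from applying.    *)
Record fps (R : Type) := Fps { fps_coef :> nat -> R }.

HB.instance Definition _ (R : Type) := gen_eqMixin (fps R).
HB.instance Definition _ (R : Type) := gen_choiceMixin (fps R).

Lemma fpsP (R : Type) (f g : fps R) : (forall n, f n = g n) <-> f = g.
Proof.
split=> [|-> //]; case: f => f; case: g => g /= fg.
by congr Fps; apply/funext.
Qed.

Section Ring.
Variable R : comUnitRingType.
Implicit Types f g h : fps R.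

Definition fps_zero : fps R := Fps (fun=> 0).
Definition fps_opp f : fps R := Fps (fun n => - f n).
Definition fps_add f g : fps R := Fps (fun n => f n + g n).
Definition fps_one : fps R := Fps (fun n => (n == 0%N)%:R).
Definition fps_mul f g : fps R :=
  Fps (fun n => \sum_(i < n.+1) f i * g (n - i)%N).

Fact fps_addA : associative fps_add.
Proof. by move=> f g h; apply/fpsP => n /=; rewrite addrA. Qed.

Fact fps_addC : commutative fps_add.
Proof. by move=> f g; apply/fpsP => n /=; rewrite addrC. Qed.

Fact fps_add0 : left_id fps_zero fps_add.
Proof. by move=> f; apply/fpsP => n /=; rewrite add0r. Qed.

Fact fps_addN : left_inverse fps_zero fps_opp fps_add.
Proof. by move=> f; apply/fpsP => n /=; rewrite addNr. Qed.

HB.instance Definition _ := GRing.isZmodule.Build (fps R)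
  fps_addA fps_addC fps_add0 fps_addN.

Definition fps_trunc (N : nat) f : {poly R} := \poly_(i < N.+1) f i.

Lemma coef_fps_trunc N f n : (n <= N)%N -> (fps_trunc N f)`_n = f n.
Proof. by move=> nN; rewrite coef_poly ltnS nN. Qed.

Lemma fps_mul_trunc N f g n : (n <= N)%N ->
  fps_mul f g n = (fps_trunc N f * fps_trunc N g)`_n.
Proof.
move=> nN; rewrite coefM /=; apply: eq_bigr => i _.
rewrite !coef_fps_trunc //; first exact: leq_trans (leq_subr _ _) nN.
by apply: leq_trans nN; rewrite -ltnS.
Qed.

Fact fps_mulC : commutative fps_mul.
Proof.
by move=> f g; apply/fpsP => n; rewrite !(@fps_mul_trunc n) // mulrC.
Qed.

Fact fps_mulA : associative fps_mul.
Proof.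
move=> f g h; apply/fpsP => n.
transitivity ((fps_trunc n f * (fps_trunc n g * fps_trunc n h))`_n).
  rewrite coefM /=; apply: eq_bigr => i _.
  have iN : (i <= n)%N by rewrite -ltnS.
  by rewrite coef_fps_trunc // -fps_mul_trunc ?leq_subr.
rewrite mulrA coefM /=; apply: eq_bigr => i _.
have iN : (i <= n)%N by rewrite -ltnS.
by rewrite -fps_mul_trunc // coef_fps_trunc ?leq_subr.
Qed.

Fact fps_mul1 : left_id fps_one fps_mul.
Proof.
move=> f; apply/fpsP => n /=.
by rewrite big_ord_recl /= mul1r subn0 big1 ?addr0 // => i _; rewrite mul0r.
Qed.

Fact fps_mulDl : left_distributive fps_mul fps_add.
Proof.
move=> f g h; apply/fpsP => n /=.
by rewrite -big_split; apply: eq_bigr => i _; rewrite mulrDl.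
Qed.

Fact fps_one_neq0 : fps_one != fps_zero.
Proof. by apply/eqP => /fpsP /(_ 0%N) /eqP; rewrite /= oner_eq0. Qed.

HB.instance Definition _ := GRing.Zmodule_isComNzRing.Build (fps R)
  fps_mulA fps_mulC fps_mul1 fps_mulDl fps_one_neq0.

Lemma coef_fpsD f g n : (f + g) n = f n + g n. Proof. by []. Qed.

Lemma coef_fpsN f n : (- f) n = - f n. Proof. by []. Qed.

Lemma coef_fps1 n : (1 : fps R) n = (n == 0%N)%:R. Proof. by []. Qed.

Lemma coef_fpsM f g n : (f * g) n = \sum_(i < n.+1) f i * g (n - i)%N.
Proof. by []. Qed.

(* [fps_invs f n] lists the coefficients 0, ..., n of the inverse of f, from  *)
(* the recursion f_0 g_{n+1} = - \sum_{i <= n} f_{i+1} g_{n-i}.               *)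
Fixpoint fps_invs f (n : nat) : seq R :=
  if n isn't n'.+1 then [:: (f 0%N)^-1] else
  let s := fps_invs f n' in
  rcons s (- (f 0%N)^-1 * \sum_(i < n) f i.+1 * s`_(n' - i)).

Definition fps_unit : pred (fps R) := fun f => f 0%N \is a GRing.unit.

Definition fps_inv f : fps R :=
  if fps_unit f then Fps (fun n => (fps_invs f n)`_n) else f.

Lemma size_fps_invs f n : size (fps_invs f n) = n.+1.
Proof. by elim: n => //= n IHn; rewrite size_rcons IHn. Qed.

Lemma nth_fps_invs f n i : (i <= n)%N -> (fps_invs f n)`_i = (fps_invs f i)`_i.
Proof.
elim: n => [|n IHn]; first by rewrite leqn0 => /eqP ->.
rewrite leq_eqVlt ltnS => /predU1P[-> // | le_in].
by rewrite /= nth_rcons size_fps_invs ltnS le_in IHn.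
Qed.

Fact fps_mulVr : {in fps_unit, left_inverse 1 fps_inv *%R}.
Proof.
move=> f fU; rewrite mulrC; apply/fpsP => -[|n].
  by rewrite /= big_ord1 subn0 /fps_inv ifT //= divrr.
rewrite coef_fpsM coef_fps1 big_ord_recl subn0 /fps_inv ifT //=.
rewrite nth_rcons size_fps_invs ltnn eqxx mulNr mulrN mulrA divrr // mul1r.
apply/eqP; rewrite addrC subr_eq0; apply/eqP/eq_bigr => i _.
by rewrite /bump /= add1n subSS [in RHS]nth_fps_invs // leq_subr.
Qed.

Fact fps_unitPl f g : g * f = 1 -> fps_unit f.
Proof.
move=> /fpsP /(_ 0%N); rewrite coef_fpsM big_ord1 subnn => gf1.
by apply/unitrPr; exists (g 0%N); rewrite mulrC.
Qed.

Fact fps_inv_out : {in [predC fps_unit], fps_inv =1 id}.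
Proof. by move=> f /negbTE fU; rewrite /fps_inv ifF. Qed.

HB.instance Definition _ := GRing.ComNzRing_hasMulInverse.Build (fps R)
  fps_mulVr fps_unitPl fps_inv_out.

Lemma fps_unitE f : (f \is a GRing.unit) = (f 0%N \is a GRing.unit).
Proof. by []. Qed.

Definition fpsX : fps R := Fps (fun n => (n == 1%N)%:R).

(* Limit in the X-adic topology: every coefficient is eventually constant.    *)
Definition fps_cvg (u : nat -> fps R) (f : fps R) : Prop :=
  forall n, exists N, forall m, (N <= m)%N -> u m n = f n.

(* The limit of u, or 0 if u does not converge. *)
Definition fps_lim (u : nat -> fps R) : fps R := xget 0 [set f | fps_cvg u f].

Lemma fps_cvg_lim u f : fps_cvg u f -> fps_lim u = f.
Proof.
move=> uf; rewrite /fps_lim; case: xgetP => [g _ ug | /(_ f) //].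
apply/fpsP => n; have [N uN] := uf n; have [M uM] := ug n.
by rewrite -(uN (maxn N M)) ?leq_maxl // -(uM (maxn N M)) ?leq_maxr.
Qed.

(* The q-Pochhammer symbol (a; q)_oo, for formal power series a and q. *)
Definition qPochhammer (a q : fps R) : fps R :=
  fps_lim (fun N => \prod_(0 <= j < N) (1 - a * q ^+ j)).

Lemma fps_mul_order f g m n :
  (forall i, (i < m)%N -> f i = 0) -> (forall i, (i < n)%N -> g i = 0) ->
  forall i, (i < m + n)%N -> (f * g) i = 0.
Proof.
move=> f0 g0 i ltimn; rewrite coef_fpsM big1 // => j _.
have [ltjm | lemj] := ltnP j m; first by rewrite f0 ?mul0r.
rewrite g0 ?mulr0 //.
have leji : (j <= i)%N by rewrite -ltnS.
by rewrite ltn_subLR // (leq_trans ltimn) // leq_add2r.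
Qed.

(* The product converges as soon as a and q have no constant term, and the    *)
(* coefficient of X^n is already that of the partial products of n factors.   *)
Lemma coef_qPochhammer (a q : fps R) (n N : nat) :
  a 0%N = 0 -> q 0%N = 0 -> (n <= N)%N ->
  qPochhammer a q n = (\prod_(0 <= j < N) (1 - a * q ^+ j)) n.
Proof.
move=> a0 q0; pose u N := \prod_(0 <= j < N) (1 - a * q ^+ j).
have q_order j : forall i, (i < j)%N -> (q ^+ j) i = 0.
  elim: j => // j IHj; rewrite exprS -add1n; apply: fps_mul_order IHj => i.
  by rewrite ltnS leqn0 => /eqP ->.
have aq_order j : forall i, (i < j.+1)%N -> (a * q ^+ j) i = 0.
  rewrite -add1n; apply: fps_mul_order (q_order j) => i.
  by rewrite ltnS leqn0 => /eqP ->.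
have uS M : u M.+1 = u M * (1 - a * q ^+ M) by rewrite /u big_nat_recr.
have u_const k M : (k <= M)%N -> u M k = u k k.
  elim: M => [|M IHM]; first by rewrite leqn0 => /eqP ->.
  rewrite leq_eqVlt => /predU1P[-> // | ltkM].
  rewrite -IHM // uS mulrBr mulr1 coef_fpsD coef_fpsN.
  by rewrite (@fps_mul_order _ _ 0 M.+1 _ (aq_order M)) ?subr0 // ltnW.
have u_cvg : fps_cvg u (Fps (fun k => u k k)).
  by move=> k; exists k => M /u_const.
by move=> lenN; rewrite /qPochhammer (fps_cvg_lim u_cvg) /= -(u_const n N).
Qed.

Lemma qPochhammer_unit (a q : fps R) :
  a 0%N = 0 -> q 0%N = 0 -> qPochhammer a q \is a GRing.unit.
Proof.
by move=> a0 q0; rewrite fps_unitE (@coef_qPochhammer a q 0 0) // big_nil unitr1.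
Qed.

End Ring.

(* (q; q)_oo^9 / (q^3; q^3)_oo^5 in Z[[q]]; the divisor is a unit there.       *)
Definition eta_quotient_1_9_3_m5 : fps int :=
  let q := fpsX int in
  qPochhammer q q ^+ 9 / qPochhammer (q ^+ 3) (q ^+ 3) ^+ 5.

Lemma eta_quotient_1_9_3_m5_unit :
  qPochhammer (fpsX int ^+ 3) (fpsX int ^+ 3) ^+ 5 \is a GRing.unit.
Proof.
have X3 : (fpsX int ^+ 3) 0%N = 0.
  by rewrite exprS coef_fpsM big_ord1 mul0r.
by rewrite unitrX // qPochhammer_unit.
Qed.

Definition C_1_9_3_m5 (n : nat) : int := eta_quotient_1_9_3_m5 n.

Definition s_1_9_3_m5 (n : nat) : int := sgz (C_1_9_3_m5 n).

(* Main.v *)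
From HB Require Import structures.
Require Import Defs.
From mathcomp Require Import all_boot all_order all_algebra all_field.
From mathcomp Require Import ring lra zify.

(* Write [E_k] for [(q^k; q^k)_oo]. Let [a] be the theta series of the Eisenstein
   integers, which is also the Lambert series [1 + 6 sum_n sum_(d | n) (d|3) q^n],
   and let [c = 3 E_3^3 / E_1]. Jacobi's identity for [E_1^3] gives
   [E_1^3 = E_3 (a(q^3) - q c(q^3))], so the eta quotient is
   [(a(q^3) - q c(q^3))^3 / E_3^2]. Its coefficients at [n = 1, 2 mod 3] are those
   of [- 3 a^2 c / E_1^2] and [3 a c^2 / E_1^2], whose signs are clear as [a] and
   [c] have nonnegative coefficients; at [n = 0 mod 3] they are those of
   [(a^3 - q c^3) / E_1^2 = E_1^7 / E_3^3], by the cubic identity of the Borweins.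
   That series is trisected once more, with
   [E_1 = E_3 (A(q^3) - q B(q^3) - q^2 D(q^3))], where [A], [B], [D] are the inverses
   of the products of the [1 - q^n] over [n = +-1, +-2, +-3], [n = +-1, +-3, +-4]
   and [n = +-2, +-3, +-4 mod 9]. The parts that arise are
   [Z0 = a^2 A + q (2 a c D - c^2 B)], [- (a^2 B + 2 a c A + q c^2 D)] and
   [Z2 = 2 a c B + c^2 A - a^2 D]. Now [D <= B <= (1 + q) D <= A] coefficientwise, and
   [D], [(1 + q) D] have the factor [1 / (1 - q)] up to small corrections, so [Z0]
   and [Z2] are positive by comparison of the partial sums of [a] and [c]. These
   grow at the same linear rate, with explicit bounds from the Lambert series. *)

Set Implicit Arguments.
Unset Strict Implicit.
Unset Printing Implicit Defensive.
Import Order.TTheory GRing.Theory Num.Theory.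
Local Open Scope ring_scope.

(** * Formal power series modulo [X ^ N] *)

Section Truncation.
Variable R : comUnitRingType.
Implicit Types f g h : fps R.
Local Notation X := (fpsX R).

(** Infinite products are handled modulo every power of [X] through finite identities: a finite
    triple product is a polynomial in [z] over the power series, so no Laurent series in [z] occurs.
    The obstacle in the last step is that single coefficients of [a] and [c] fluctuate and often
    vanish: [2 c - a], for instance, has coefficients of both signs. Only the partial sums, that is
    the products by [1 / (1 - q)], can be compared. For this [c] has to be expressed through [a].
    Jacobi's identity yields [E_1^3 / E_3] with [a] as a Lambert series. The constant term in [z] of
    three triple products, at [z], [w z] and [w^2 z] with [w] a cube root of unity, yields the same
    quotient as the sum of [w^(x - y) q^(x^2 + x y + y^2)]. Comparing both gives [a(3n) = a(n)],
    [a(3n+1) = 2 c(n)] and [a(3n+2) = 0], so that partial sums of [c] are differences of partial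
    sums of [a]. The common growth rate is [2 pi / sqrt 3 = 3.627...]; the rational bounds 3.51 and
    3.84 are close enough to settle all [n >= 140], and a computation settles the rest. *)

Definition fps_eqmod N f g := forall n, (n < N)%N -> f n = g n.

Lemma eqmod_refl N f : fps_eqmod N f f. Proof. by []. Qed.

Lemma eqmod_sym N f g : fps_eqmod N f g -> fps_eqmod N g f.
Proof. by move=> fg n /fg. Qed.

Lemma eqmod_trans N g f h : fps_eqmod N f g -> fps_eqmod N g h -> fps_eqmod N f h.
Proof. by move=> fg gh n nN; rewrite fg // gh. Qed.

Lemma eqmodW N M f g : (M <= N)%N -> fps_eqmod N f g -> fps_eqmod M f g.
Proof. by move=> MN fg n nM; apply: fg; apply: leq_trans MN. Qed.

Lemma eq_from_eqmod f g : (forall N, fps_eqmod N f g) -> f = g.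
Proof. by move=> fg; apply/fpsP => n; apply: (fg n.+1). Qed.

Lemma eqmodD N f1 f2 g1 g2 : fps_eqmod N f1 g1 -> fps_eqmod N f2 g2 ->
  fps_eqmod N (f1 + f2) (g1 + g2).
Proof. by move=> h1 h2 n nN; rewrite !coef_fpsD h1 // h2. Qed.

Lemma eqmodN N f g : fps_eqmod N f g -> fps_eqmod N (- f) (- g).
Proof. by move=> h n nN; rewrite !coef_fpsN h. Qed.

Lemma eqmodB N f1 f2 g1 g2 : fps_eqmod N f1 g1 -> fps_eqmod N f2 g2 ->
  fps_eqmod N (f1 - f2) (g1 - g2).
Proof. by move=> h1 h2; apply: eqmodD => //; apply: eqmodN. Qed.

Lemma eqmodM N f1 f2 g1 g2 : fps_eqmod N f1 g1 -> fps_eqmod N f2 g2 ->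
  fps_eqmod N (f1 * f2) (g1 * g2).
Proof.
move=> h1 h2 n nN; rewrite !coef_fpsM; apply: eq_bigr => i _.
rewrite h1 ?h2 //; first by apply: leq_ltn_trans nN; rewrite leq_subr.
by apply: leq_ltn_trans nN; rewrite -ltnS.
Qed.

Lemma eqmod_sum N (I : Type) (r : seq I) (P : pred I) (F G : I -> fps R) :
  (forall i, P i -> fps_eqmod N (F i) (G i)) ->
  fps_eqmod N (\sum_(i <- r | P i) F i) (\sum_(i <- r | P i) G i).
Proof. by move=> FG; elim/big_rec2: _ => // i f g Pi fg; apply: eqmodD => //; apply:
    FG. Qed.

Lemma eqmod_prod N (I : Type) (r : seq I) (P : pred I) (F G : I -> fps R) :
  (forall i, P i -> fps_eqmod N (F i) (G i)) ->
  fps_eqmod N (\prod_(i <- r | P i) F i) (\prod_(i <- r | P i) G i).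
Proof. by move=> FG; elim/big_rec2: _ => // i f g Pi fg; apply: eqmodM => //; apply:
    FG. Qed.

Lemma coef_fps_sum (I : Type) (r : seq I) (P : pred I) (F : I -> fps R) n :
  (\sum_(i <- r | P i) F i) n = \sum_(i <- r | P i) F i n.
Proof. exact: (big_morph (fun f : fps R => f n) (fun _ _ => erefl) (erefl _)). Qed.

Lemma coef_fpsMX f n : (X * f) n = if n is m.+1 then f m else 0.
Proof.
rewrite coef_fpsM; case: n => [|n]; first by rewrite big_ord1 mul0r.
rewrite big_ord_recl mul0r add0r big_ord_recl /= mul1r big1 ?addr0 //.
  by rewrite /bump /= subSS subn0.
by move=> i _; rewrite mul0r.
Qed.

Lemma coef_fpsMXn k f n : (X ^+ k * f) n = if (k <= n)%N then f (n - k)%N else 0.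
Proof.
elim: k n => [|k IH] n; first by rewrite mul1r subn0.
by rewrite exprS -mulrA coef_fpsMX; case: n => [|n]; rewrite ?IH.
Qed.

Lemma coef_fpsXn k n : (X ^+ k) n = (n == k)%:R.
Proof.
rewrite -[X ^+ k]mulr1 coef_fpsMXn coef_fps1 subn_eq0.
by case: ltngtP.
Qed.

Lemma coef_fps_natM a f n : (a%:R * f) n = a%:R * f n.
Proof.
by elim: a => [|a IH]; rewrite ?mul0r // !mulrSr !mulrDl !mul1r coef_fpsD IH.
Qed.

Lemma eqmod_Xn0 N k : (N <= k)%N -> fps_eqmod N (X ^+ k) 0.
Proof. by move=> Nk n nN; rewrite coef_fpsXn; case: eqP => // nk; lia. Qed.

Lemma eqmod_unit_cancel N u f g : u \is a GRing.unit ->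
  fps_eqmod N (u * f) (u * g) -> fps_eqmod N f g.
Proof.
move=> uU fg; rewrite -[f](mulKr uU) -[g](mulKr uU).
by apply: eqmodM.
Qed.

Lemma coef_fpsM0 f g : (f * g) 0%N = f 0%N * g 0%N.
Proof. by rewrite coef_fpsM big_ord1. Qed.

Lemma fps_unit1BXn k : (0 < k)%N -> 1 - X ^+ k \is a GRing.unit.
Proof.
move=> k0; rewrite fps_unitE coef_fpsD coef_fpsN coef_fpsXn coef_fps1.
by case: k k0 => // k _; rewrite subr0 unitr1.
Qed.

Definition fps_geom k : fps R := (1 - X ^+ k)^-1.

Lemma fps_geomK k : (0 < k)%N -> (1 - X ^+ k) * fps_geom k = 1.
Proof. by move=> k0; rewrite mulrV // fps_unit1BXn. Qed.

Lemma coef_fps_geom k n : (0 < k)%N -> fps_geom k n = (k %| n)%:R.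
Proof.
move=> k0; rewrite /fps_geom; suff -> : (1 - X ^+ k)^-1 = Fps (fun n =>
    (k %| n)%:R) by [].
apply: (mulrI (fps_unit1BXn k0)); rewrite mulrV ?fps_unit1BXn //.
apply/fpsP => m; rewrite mulrBl mul1r coef_fpsD coef_fpsN coef_fpsMXn coef_fps1 /=.
have [km|mk] := leqP k m.
  rewrite dvdn_subl // subrr; case: m km => //; lia.
by rewrite subr0; case: m mk => [|m] mk; rewrite ?dvdn0 // gtnNdvd.
Qed.

(* Locked, since failing unifications would otherwise compute coefficients. *)
Definition qpoch : nat -> nat -> fps R :=
  locked (fun m i => qPochhammer (X ^+ i) (X ^+ m)).

Lemma qpochE m i : qpoch m i = qPochhammer (X ^+ i) (X ^+ m).
Proof. by rewrite /qpoch -lock. Qed.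

(** The factor of index [j] is 1 modulo [X ^ j.+1], so [N] factors already fix the coefficient of
    [X ^ N]; hence the modulus [N.+1]. *)
Lemma eqmod_qpoch m i N : (0 < m)%N -> (0 < i)%N ->
  fps_eqmod N.+1 (qpoch m i) (\prod_(j < N) (1 - X ^+ (i + m * j))).
Proof.
move=> m0 i0 n nN; rewrite qpochE (@coef_qPochhammer _ _ _ n N) //.
- rewrite big_mkord; congr (fps_coef _ n); apply: eq_bigr => j _.
  by rewrite exprD exprM.
- by rewrite coef_fpsXn; case: i i0.
- by rewrite coef_fpsXn; case: m m0.
Qed.

Lemma qpoch_unit m i : (0 < m)%N -> (0 < i)%N -> qpoch m i \is a GRing.unit.
Proof.
by move=> m0 i0; rewrite qpochE; apply: qPochhammer_unit; rewrite coef_fpsXn; [case: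
    i i0|case: m m0].
Qed.

Lemma qpoch_recl m i : (0 < m)%N -> (0 < i)%N ->
  qpoch m i = (1 - X ^+ i) * qpoch m (i + m).
Proof.
move=> m0 i0; have im0 : (0 < i + m)%N by rewrite addn_gt0 i0.
apply: eq_from_eqmod => N; apply: (@eqmodW N.+1) => //.
apply: eqmod_trans (eqmodW _ (@eqmod_qpoch _ _ N.+1 m0 i0)) _ => //.
apply: eqmod_trans (eqmodM (@eqmod_refl _ _) (eqmod_sym (@eqmod_qpoch _ _ N m0 im0))).
rewrite big_ord_recl muln0 addn0; apply: eqmodM => //; apply: eqmod_prod => j _.
by rewrite lift0 mulnS addnA.
Qed.

Lemma qpoch_trisect m i : (0 < m)%N -> (0 < i)%N ->
  qpoch m i = qpoch (3 * m) i * qpoch (3 * m) (i + m) * qpoch (3 * m) (i + 2 * m).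
Proof.
move=> m0 i0; apply: eq_from_eqmod => N; apply: (@eqmodW N.+1) => //.
have H k : (0 < k)%N -> fps_eqmod N.+1 (\prod_(j < N) (1 - X ^+ (k + 3 * m *
    j))) (qpoch (3 * m) k).
  by move=> k0; apply: eqmod_sym; apply: eqmod_qpoch => //; rewrite muln_gt0.
apply: eqmod_trans (eqmodM (eqmodM (H _ _) (H _ _)) (H _ _)); rewrite ?addn_gt0 ?i0 //.
apply: eqmod_trans (eqmodW _ (@eqmod_qpoch _ _ (3 * N) m0 i0)) _; first by lia.
rewrite -!big_split /=.
suff -> : \prod_(j < 3 * N) (1 - X ^+ (i + m * j)) =
   \prod_(j < N) ((1 - X ^+ (i + 3 * m * j)) * (1 - X ^+ (i + m + 3 * m * j))
      * (1 - X ^+ (i + 2 * m + 3 * m * j))) by [].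
elim: (N) => [|n IH]; first by rewrite !big_ord0.
rewrite mulnS !addSn add0n !big_ord_recr /= IH -!mulrA.
by congr (_ * (_ * (_ * _))); congr (1 - X ^+ _); lia.
Qed.

End Truncation.

(** * The finite triple product *)

Section GaussBinomial.
Variables (R : comNzRingType) (p : R).

(** Gaussian binomial coefficients in base [p]. The q-Pascal rule avoids a division by
    [1 - p ^ j]. *)
Fixpoint gauss_bin (n k : nat) : R :=
  match n, k with
  | _, 0 => 1
  | 0, _.+1 => 0
  | n.+1, k.+1 => gauss_bin n k + p ^+ k.+1 * gauss_bin n k.+1
  end.

Lemma gauss_bin0 n : gauss_bin n 0 = 1. Proof. by case: n. Qed.

Lemma gauss_binS n k :
  gauss_bin n.+1 k.+1 = gauss_bin n k + p ^+ k.+1 * gauss_bin n k.+1.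
Proof. by []. Qed.

Lemma gauss_bin_small n k : (n < k)%N -> gauss_bin n k = 0.
Proof.
elim: n k => [|n IH] [|k] // nk; rewrite gauss_binS !IH ?mulr0 ?addr0 //.
exact: ltnW.
Qed.

(** The second q-Pascal rule. In the finite triple product, a new factor of the form [1 - q ^ d z]
    calls for this rule and a new factor [z - q ^ d] for [gauss_binS]. *)
Lemma gauss_binS_sym n k :
  gauss_bin n.+1 k.+1 = gauss_bin n k.+1 + p ^+ (n - k) * gauss_bin n k.
Proof.
elim: n k => [|n IH] k; first by case: k => [|k] /=;
    rewrite ?mulr0 ?mulr1 ?addr0 ?add0r ?expr0.
rewrite [LHS]gauss_binS; case: k => [|k].
  rewrite subn0 !gauss_bin0 [in LHS]IH subn0 gauss_bin0 gauss_binS gauss_bin0 (exprS p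
      n) expr1; ring.
rewrite subSS [in LHS](IH k) [in LHS](IH k.+1) (gauss_binS n k.+1) (gauss_binS n k).
have [kn|nk] := ltnP k n; last by rewrite (@gauss_bin_small n k.+1) // !mulr0; ring.
have -> : p ^+ (n - k) = p * p ^+ (n - k.+1) by rewrite -exprS; congr (_ ^+ _); lia.
by rewrite !exprS; ring.
Qed.

Definition gauss_fact n : R := \prod_(j < n) (1 - p ^+ j.+1).

Lemma gauss_factS n : gauss_fact n.+1 = gauss_fact n * (1 - p ^+ n.+1).
Proof. by rewrite /gauss_fact big_ord_recr. Qed.

Lemma gauss_bin_fact n k : (k <= n)%N ->
  gauss_bin n k * gauss_fact k * gauss_fact (n - k) = gauss_fact n.
Proof.
have f0 : gauss_fact 0 = 1 by rewrite /gauss_fact big_ord0.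
elim: n k => [|n IH] [|k] // kn; rewrite ?gauss_bin0 ?f0 ?mul1r ?mulr1 ?subn0 //.
rewrite subSS gauss_binS mulrDl mulrDl [in LHS]gauss_factS.
move: kn; rewrite ltnS leq_eqVlt => /predU1P[->|kn].
  have H := IH n (leqnn n); rewrite subnn f0 mulr1 in H.
  rewrite gauss_factS -[in RHS]H subnn f0 (@gauss_bin_small n n.+1) //; ring.
have E : (n - k = (n - k.+1).+1)%N by lia.
have H1 := IH k (ltnW kn); have H2 := IH k.+1 kn.
transitivity (gauss_fact n * (1 - p ^+ k.+1) + p ^+ k.+1 * gauss_fact n * (1 -
    p ^+ (n - k))).
  by rewrite -{1}H1 -H2 E !gauss_factS; ring.
by rewrite gauss_factS (_ : n.+1 = k.+1 + (n - k))%N ?exprD; [ring|lia].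
Qed.

End GaussBinomial.

Arguments gauss_bin {R} p n k : simpl never.

(* [theta_exp m i t] is [m t (t - 1) / 2 + i t], which is nonnegative for
   [0 <= i <= m]. *)
Definition theta_exp (m i : nat) (t : int) : nat :=
  match t with
  | Posz t => m * 'C(t, 2) + i * t
  | Negz u => m * 'C(u.+1, 2) + (m - i) * u.+1
  end.

Arguments theta_exp : simpl never.

Lemma bin2E n : ('C(n, 2)%:Z * 2 = n%:Z * (n%:Z - 1))%R.
Proof.
elim: n => [|n IH] //; rewrite binS bin1 PoszD mulrDl IH; lia.
Qed.

Lemma theta_expE m i t : (i <= m)%N ->
  ((theta_exp m i t)%:Z * 2 = m%:Z * t * (t - 1) + i%:Z * t * 2)%R.
Proof.
move=> im; case: t => [t|u]; rewrite /theta_exp PoszD !PoszM mulrDl.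
  by rewrite -[m%:Z * _ * 2]mulrA bin2E; ring.
rewrite -[m%:Z * _ * 2]mulrA bin2E NegzE -subzn //.
by rewrite -addn1 PoszD; ring.
Qed.

Lemma theta_expS m i t : (i <= m)%N ->
  ((theta_exp m i (t + 1))%:Z = (theta_exp m i t)%:Z + m%:Z * t + i%:Z)%R.
Proof.
by move=> im; have := theta_expE (t + 1) im; have := theta_expE t im; lia.
Qed.

(** Terms of a theta series with [M < |t|] therefore vanish modulo [X ^ M]. The successor cannot be
    dropped: [theta_exp 1 0 1 = 0]. *)
Lemma theta_exp_ge m i t : (0 < m)%N -> (i <= m)%N -> (`|t| <= (theta_exp m i t).+1)%N.
Proof.
move=> m0 im; have := theta_expE t im; nia.
Qed.

Section Sign.
Variable R : comUnitRingType.

Definition theta_sign (t : int) : fps R := (-1) ^+ `|t|%N.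

Lemma theta_signS t : theta_sign (t + 1) = - theta_sign t.
Proof.
rewrite /theta_sign; case: (leP 0 t) => t0.
  by rewrite (_ : absz (t + 1) = (absz t).+1) ?exprS ?mulN1r //; lia.
by rewrite (_ : absz t = (absz (t + 1)).+1) ?exprS ?mulN1r ?opprK //; lia.
Qed.

End Sign.

Section FiniteTripleProduct.
Variable R : comUnitRingType.
Variables (m i : nat) (w : fps R).
Hypothesis im : (i <= m)%N.
Local Notation X := (fpsX R).
Local Notation isgn := (@theta_sign R).
Local Notation "[ 'gb' n , k ]" := (gauss_bin (X ^+ m) n k).

(* The scaling [w] of the variable will be a cube root of unity. *)
Definition triple_prod n l : {poly fps R} :=
  \prod_(j < n) (w%:P * 'X - (X ^+ (m - i + m * j))%:P) *
  \prod_(j < l) (1 - (w * X ^+ (i + m * j))%:P * 'X).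

(** A finite form of the Jacobi triple product. The first product is [(w z) ^ n] times a product in
    [1 / z], which is why the coefficient of [z ^ k] is the theta term at [t = k - n]. The induction
    adds factors of the second product for [n = 0], then factors of the first. *)
Lemma coef_triple_prod n l k :
  (triple_prod n l)`_k =
  w ^+ k * isgn (k%:Z - n%:Z) * X ^+ theta_exp m i (k%:Z - n%:Z) * [gb n + l, k].
Proof.
rewrite /triple_prod; elim: n l k => [|n IHn] l k.
  rewrite big_ord0 mul1r subr0; elim: l k => [|l IHl] k.
    by rewrite big_ord0 coef1; case: k => [|k] /=;
        rewrite ?mulr0 // /isgn /theta_exp !muln0 !expr0 !mulr1.
  rewrite big_ord_recr /= mulrBr mulr1 coefB mulrCA coefCM coefMX.
  case: k => [|k] /=; first by rewrite mulr0 subr0 IHl add0n !gauss_bin0.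
  rewrite !IHl !add0n [in RHS]gauss_binS_sym (_ : k.+1%:Z = k%:Z + 1) ?theta_signS;
      last by lia.
  have [kl|lk] := leqP k l; last first.
    by rewrite !(@gauss_bin_small _ (X ^+ m) l) ?ltnS ?(ltnW lk) //; ring.
  have E : X ^+ (i + m * l) * X ^+ theta_exp m i k
         = X ^+ theta_exp m i (k%:Z + 1) * X ^+ m ^+ (l - k).
    rewrite -exprM -!exprD; congr (_ ^+ _); have := theta_expS k im.
    move: (theta_exp _ _ _) (theta_exp _ _ _) => a b; nia.
  transitivity (w ^+ k.+1 * (- isgn k) * X ^+ theta_exp m i (k%:Z + 1) * [gb l, k.+1]
     - w ^+ k.+1 * isgn k * [gb l, k] * (X ^+ (i + m * l) * X ^+ theta_exp m i k)).
    by rewrite exprS; ring.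
  by rewrite E; ring.
rewrite big_ord_recr /= mulrAC mulrBr coefB mulrCA coefCM coefMX coefMC.
have sE (a : int) : a - n.+1%:Z + 1 = a - n%:Z by lia.
case: k => [|k] /=.
  rewrite IHn !gauss_bin0 -(sE 0) theta_signS.
  have E : X ^+ (m - i + m * n) * X ^+ theta_exp m i (0 - n.+1%:Z + 1) =
           X ^+ theta_exp m i (0 - n.+1%:Z).
    rewrite -!exprD; congr (_ ^+ _); have := theta_expS (0 - n.+1%:Z) im.
    move: (theta_exp _ _ _) (theta_exp _ _ _) => a b; nia.
  by rewrite -E; ring.
rewrite !IHn addSn gauss_binS -(sE k.+1%:Z) theta_signS.
have -> : k.+1%:Z - n.+1%:Z = k%:Z - n%:Z by lia.
have E : X ^+ (m - i + m * n) * X ^+ theta_exp m i (k%:Z - n%:Z + 1) =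
         X ^+ theta_exp m i (k%:Z - n%:Z) * X ^+ m ^+ k.+1.
  rewrite -exprM -!exprD; congr (_ ^+ _); have := theta_expS (k%:Z - n%:Z) im.
  move: (theta_exp _ _ _) (theta_exp _ _ _) => a b; nia.
transitivity (w ^+ k.+1 * isgn (k%:Z - n%:Z) * X ^+ theta_exp m i (k%:Z - n%:Z) *
    [gb n + l, k]
  + w ^+ k.+1 * isgn (k%:Z - n%:Z) * [gb n + l, k.+1] *
   (X ^+ (m - i + m * n) * X ^+ theta_exp m i (k%:Z - n%:Z + 1))).
  by rewrite exprS; ring.
by rewrite E; ring.
Qed.

End FiniteTripleProduct.

(** * Theta functions *)

Section BilateralSums.
Variable V : comNzRingType.
Implicit Types F G : int -> V.

Definition bsum n F : V := \sum_(k < (2 * n).+1) F (k%:Z - n%:Z).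

Lemma bsum0 F : bsum 0 F = F 0.
Proof. by rewrite /bsum big_ord1. Qed.

Lemma bsumS n F : bsum n.+1 F = F (- n.+1%:Z) + bsum n F + F n.+1%:Z.
Proof.
rewrite /bsum mulnS !addSn add0n big_ord_recr big_ord_recl /=; congr (_ + _ + _).
- by congr F; lia.
- by apply: eq_bigr => k _; congr F; rewrite /bump /=; lia.
- by congr F; lia.
Qed.

Lemma eq_bsum n F G : F =1 G -> bsum n F = bsum n G.
Proof. by move=> FG; apply: eq_bigr => k _; rewrite FG. Qed.

Lemma bsumD n F G : bsum n (fun t => F t + G t) = bsum n F + bsum n G.
Proof. exact: big_split. Qed.

Lemma bsum_opp n F : bsum n (fun t => F (- t)) = bsum n F.
Proof.
elim: n => [|n IH]; first by rewrite !bsum0.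
by rewrite !bsumS IH opprK; ring.
Qed.

(** The range from [- (3 n + 1)] to [3 n + 1] is the one on which the classes of 0, 1 and -1 modulo
    3 all become symmetric ranges of the same length. *)
Lemma bsum_trisect n F :
  bsum (3 * n).+1 F = bsum n (fun t => F (3 * t) + F (3 * t + 1) + F (3 * t - 1)).
Proof.
elim: n => [|n IH]; first by rewrite bsumS !bsum0 mulr0 add0r sub0r -addrA addrC.
rewrite [RHS]bsumS -IH mulnS !addSn add0n bsumS.
rewrite (bsumS (3 * n).+2) (bsumS (3 * n).+1).
have -> : - (3 * n).+4%:Z = 3 * - n.+1%:Z - 1 by lia.
have -> : - (3 * n).+3%:Z = 3 * - n.+1%:Z by lia.
have -> : - (3 * n).+2%:Z = 3 * - n.+1%:Z + 1 by lia.
have -> : (3 * n).+4%:Z = 3 * n.+1%:Z + 1 by lia.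
have -> : (3 * n).+3%:Z = 3 * n.+1%:Z by lia.
have -> : (3 * n).+2%:Z = 3 * n.+1%:Z - 1 by lia.
move: (bsum _ F) (F _) (F _) (F _) (F _) (F _) (F _) => s x1 x2 x3 x4 x5 x6.
ring.
Qed.

End BilateralSums.

Lemma bsumZ (R : comNzRingType) n c (F : int -> R) : bsum n (fun t => c * F t) = c *
    bsum n F.
Proof. by rewrite /bsum mulr_sumr. Qed.

Lemma bsumN (V : comNzRingType) n (F : int -> V) : bsum n (fun t => - F t) = - bsum n F.
Proof. by rewrite /bsum -sumrN. Qed.

Lemma eqmod_bsum (R : comUnitRingType) N n (F G : int -> fps R) :
  (forall t, (`|t| <= n)%N -> fps_eqmod N (F t) (G t)) ->
  fps_eqmod N (bsum n F) (bsum n G).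
Proof.
move=> FG; apply: eqmod_sum => k _; apply: FG; have := ltn_ord k; lia.
Qed.

Lemma deriv_prod_horner1 (S : comNzRingType) n (P : nat -> {poly S}) (a : nat -> S) :
  (forall j, (P j)^`().[1] = (P j).[1] * a j) ->
  (\prod_(j < n) P j)^`().[1] = (\prod_(j < n) P j).[1] * \sum_(j < n) a j.
Proof.
move=> H; elim: n => [|n IH]; first by rewrite !big_ord0 derivE hornerC mulr0.
by rewrite !big_ord_recr /= derivM hornerD !hornerM IH H; ring.
Qed.

Section GaussBinomialLimit.
Variables (R : comUnitRingType) (m : nat).
Local Notation X := (fpsX R).

Lemma gauss_fact_eqmod n : (0 < m)%N -> fps_eqmod n.+1 (gauss_fact (X ^+ m) n) (qpoch R
    m m).
Proof.
move=> m0; apply: eqmod_sym; apply: eqmod_trans (eqmod_qpoch _ m0 m0) _ => k _.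
by congr (fps_coef _ k); apply: eq_bigr => j _; rewrite -exprM mulnS.
Qed.

(** A Gaussian binomial tends to [1 / (q ^ m; q ^ m)_oo] when both [k] and [n - k] grow. After one
    more factor [qpoch R m m] this is [gauss_bin_fact] with the three finite factorials replaced by
    their limit. *)
Lemma qpoch_gauss_bin M n k : (0 < m)%N -> (M <= k)%N -> (k + M <= n)%N ->
  fps_eqmod M (qpoch R m m * gauss_bin (X ^+ m) n k) 1.
Proof.
move=> m0 Mk kn; have kn' : (k <= n)%N by lia.
apply: (eqmod_unit_cancel (qpoch_unit R m0 m0)); rewrite mulr1.
have H j : (M <= j)%N -> fps_eqmod M (gauss_fact (X ^+ m) j) (qpoch R m m).
  by move=> Mj; apply: (eqmodW _ (@gauss_fact_eqmod j m0)); apply: leqW.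
apply: eqmod_trans _ (H n _); last by lia.
rewrite -(gauss_bin_fact (X ^+ m) kn') mulrA mulrC mulrA.
by do 2?[apply: eqmodM]; rewrite //; apply: eqmod_sym; apply: H; lia.
Qed.

End GaussBinomialLimit.

Section TripleProduct.
Variable R : comUnitRingType.
Variables (m i : nat).
Hypothesis im : (i <= m)%N.
Local Notation X := (fpsX R).
Local Notation T := (triple_prod m i (1 : fps R)).
Local Notation isgn := (@theta_sign R).

Definition theta_term n t : fps R :=
  isgn t * X ^+ theta_exp m i t * gauss_bin (X ^+ m) (n + n) `|n%:Z + t|.

Lemma size_triple_prod (w : fps R) n : (size (triple_prod m i w n n) <= (2 * n).+1)%N.
Proof.
apply/leq_sizeP => k nk; rewrite coef_triple_prod // gauss_bin_small ?mulr0 //; lia.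
Qed.

Lemma horner_triple_prod_bsum n : (T n n).[1] = bsum n (theta_term n).
Proof.
rewrite (horner_coef_wide _ (size_triple_prod _ _)); apply: eq_bigr => k _.
rewrite coef_triple_prod // !expr1n mulr1 mul1r /theta_term.
by congr (_ * gauss_bin _ _ _); lia.
Qed.

(** The summand with [n%:R] is the derivative of the extra factor [z ^ n] in [triple_prod]. *)
Lemma deriv_triple_prod_bsum n :
  (T n n)^`().[1] = n%:R * bsum n (theta_term n) + bsum n (fun t => t%:~R *
      theta_term n t).
Proof.
have sz : (size ((T n n)^`()) <= 2 * n)%N.
  apply/leq_sizeP => k nk; rewrite coef_deriv coef_triple_prod // gauss_bin_small
      ?mulr0 ?mul0rn //; lia.
rewrite (horner_coef_wide _ sz) -bsumZ -bsumD /bsum [RHS]big_ord_recl /=.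
(* The term [t = - n] has weight [n + t = 0]; it is the constant coefficient, which the derivative
   loses. *)
rewrite [X in _ = X + _](_ : _ = 0) ?add0r; last first.
  by rewrite -mulrDl mulrNz -pmulrn subrr mul0r.
apply: eq_bigr => k _; rewrite coef_deriv coef_triple_prod // !expr1n mulr1 mul1r
    /theta_term.
rewrite -mulrDl (_ : bump 0 k = k.+1) // rmorphB /= -!pmulrn [n%:R + _]addrC subrK.
rewrite -mulr_natl; congr (_ * (_ * gauss_bin _ _ _)); lia.
Qed.

Lemma horner_triple_prod n :
  (T n n).[1] = \prod_(j < n) (1 - X ^+ (m - i + m * j)) * \prod_(j < n) (1 - X ^+ (i +
      m * j)).
Proof.
rewrite /triple_prod hornerM !horner_prod; congr (_ * _); apply: eq_bigr => j _;
by rewrite !hornerE ?mul1r.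
Qed.

(** The logarithmic derivative at [z = 1] of the product of all [(1 - q ^ (m - i + m j) / z) (1 - q
    ^ (i + m j) z)], [j < n]. *)
Definition lambert n : fps R :=
  \sum_(j < n) (X ^+ (m - i + m * j) * fps_geom R (m - i + m * j)
               - X ^+ (i + m * j) * fps_geom R (i + m * j)).

(** Both sides come from the derivative of the triple product at [z = 1], computed on the
    coefficients and on the factors. The bounds on [i] keep every exponent positive, so that each
    [1 - q ^ d] is invertible. *)
Lemma bsum_lambert n : (0 < i)%N -> (i < m)%N ->
  bsum n (fun t => t%:~R * theta_term n t) = bsum n (theta_term n) * lambert n.
Proof.
move=> i0 lim; apply: (addrI (n%:R * bsum n (theta_term n))).
rewrite -deriv_triple_prod_bsum -horner_triple_prod_bsum /triple_prod derivM hornerD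
    !hornerM.
(* The leading [1] in [a] stems from [z ^ n]: summed over [j] it gives the [n%:R] that cancels on
   the other side. *)
rewrite (deriv_prod_horner1 _
  (P := fun j => 1%:P * 'X - (X ^+ (m - i + m * j))%:P)
  (a := fun j => 1 + X ^+ (m - i + m * j) * fps_geom R (m - i + m * j))); last first.
  move=> j; rewrite !derivE !hornerE ?mul1r.
  have d0 : (0 < m - i + m * j)%N by lia.
  transitivity ((1 - X ^+ (m - i + m * j)) +
     X ^+ (m - i + m * j) * ((1 - X ^+ (m - i + m * j)) * fps_geom R (m - i + m * j)));
         last by ring.
  by rewrite fps_geomK //; ring.
rewrite (deriv_prod_horner1 _
  (P := fun j => 1 - (1 * X ^+ (i + m * j))%:P * 'X)
  (a := fun j => - (X ^+ (i + m * j) * fps_geom R (i + m * j)))); last first.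
  move=> j; rewrite !derivE !hornerE ?mul1r.
  have d0 : (0 < i + m * j)%N by lia.
  transitivity (- X ^+ (i + m * j) * ((1 - X ^+ (i + m * j)) * fps_geom R (i + m *
      j))); last by ring.
  by rewrite fps_geomK //; ring.
rewrite /lambert big_split /= sumr_const card_ord sumrB sumrN.
by ring.
Qed.

(** The weight [c] is arbitrary in order to serve both the triple product ([c = 1]) and its
    derivative ([c t = t]). For [|t| <= M] the binomial is close enough to the middle to be replaced
    by its limit, since [2 M <= n]; the other terms vanish modulo [X ^ M]. *)
Lemma eqmod_theta (c : int -> fps R) M n : (0 < m)%N -> (2 * M <= n)%N ->
  fps_eqmod M (qpoch R m m * bsum n (fun t => c t * theta_term n t))
    (bsum n (fun t => c t * (isgn t * X ^+ theta_exp m i t))).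
Proof.
move=> m0 Mn; rewrite -bsumZ; apply: eqmod_bsum => t tn.
rewrite /theta_term mulrCA; apply: eqmodM => //;
    rewrite mulrCA -[X in fps_eqmod _ _ X]mulr1.
have := theta_exp_ge t m0 im.
have [tM tge|Mt tge] := leqP `|t| M.
  by apply: eqmodM => //; apply: qpoch_gauss_bin => //; lia.
have X0 : fps_eqmod M (isgn t * X ^+ theta_exp m i t) 0.
  rewrite -[0](mulr0 (isgn t)); apply: eqmodM => //; apply: eqmod_Xn0; lia.
by apply: eqmod_trans (eqmodM X0 (@eqmod_refl _ _ _)) _; rewrite mul0r mulr1; exact:
    eqmod_sym X0.
Qed.

Lemma triple_product M n : (0 < i)%N -> (i < m)%N -> (2 * M <= n)%N ->
  fps_eqmod M (qpoch R m m * (qpoch R m (m - i) * qpoch R m i))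
    (bsum n (fun t => isgn t * X ^+ theta_exp m i t)).
Proof.
move=> i0 lim Mn; have m0 : (0 < m)%N by lia.
have mi0 : (0 < m - i)%N by lia.
have H := @eqmod_theta (fun=> 1) M n m0 Mn.
rewrite (eq_bsum _ (fun t => mul1r _)) -horner_triple_prod_bsum horner_triple_prod in H.
rewrite [X in fps_eqmod _ _ X](eq_bsum _ (fun t => mul1r _)) in H.
apply: eqmod_trans _ H; apply: eqmodM => //; apply: eqmodM.
  by apply: (eqmodW _ (eqmod_qpoch _ m0 mi0)); lia.
by apply: (eqmodW _ (eqmod_qpoch _ m0 i0)); lia.
Qed.

Lemma triple_product_deriv M n : (0 < i)%N -> (i < m)%N -> (2 * M <= n)%N ->
  fps_eqmod M (qpoch R m m * (qpoch R m (m - i) * qpoch R m i) * lambert n)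
    (bsum n (fun t => t%:~R * (isgn t * X ^+ theta_exp m i t))).
Proof.
move=> i0 lim Mn; have m0 : (0 < m)%N by lia.
have mi0 : (0 < m - i)%N by lia.
apply: eqmod_trans _ (@eqmod_theta (fun t => t%:~R) M n m0 Mn).
rewrite bsum_lambert // -horner_triple_prod_bsum horner_triple_prod.
rewrite -[X in fps_eqmod _ X _]mulrA; apply: eqmodM => //; do 2?[apply: eqmodM => //].
  by apply: (eqmodW _ (eqmod_qpoch _ m0 mi0)); lia.
by apply: (eqmodW _ (eqmod_qpoch _ m0 i0)); lia.
Qed.

End TripleProduct.

(** * The substitution of [q ^ 3] for [q] *)

Section CubeSubst.
Variable R : comUnitRingType.
Implicit Types f g : fps R.
Local Notation X := (fpsX R).

Definition cube_subst : fps R -> fps R :=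
  locked (fun f => Fps (fun n => if (3 %| n)%N then f (n %/ 3)%N else 0)).

Lemma cube_substE f n : cube_subst f n = if (3 %| n)%N then f (n %/ 3)%N else 0.
Proof. by rewrite /cube_subst -lock. Qed.

Lemma coef_cube_subst f n N : (n <= N)%N -> cube_subst f n =
    (fps_trunc N f \Po 'X^3)`_n.
Proof.
move=> nN; rewrite cube_substE coef_comp_poly_Xn //= coef_fps_trunc //.
exact: leq_trans (leq_div _ _) nN.
Qed.

Fact cube_subst_zmod_morphism : zmod_morphism cube_subst.
Proof.
move=> f g; apply/fpsP => n; rewrite coef_fpsD coef_fpsN !cube_substE.
by case: ifP => // _; rewrite subr0.
Qed.

Fact cube_subst_monoid_morphism : monoid_morphism cube_subst.
Proof.
split=> [|f g]; apply/fpsP => n.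
  by rewrite cube_substE /=; have [/dvdnP[k ->]|] := boolP (3 %| n)%N;
      [rewrite mulnK ?muln_eq0 ?orbF|case: n].
rewrite coef_fpsM; under eq_bigr => i _.
  rewrite (@coef_cube_subst f i n) -1?ltnS // (@coef_cube_subst g _ n) ?leq_subr //;
      over.
rewrite -coefM -rmorphM /= cube_substE coef_comp_poly_Xn //=; case: ifP => // _.
by rewrite -fps_mul_trunc ?leq_div.
Qed.

HB.instance Definition _ := GRing.isZmodMorphism.Build (fps R) (fps R) cube_subst
    cube_subst_zmod_morphism.
HB.instance Definition _ := GRing.isMonoidMorphism.Build (fps R) (fps R) cube_subst
    cube_subst_monoid_morphism.

Lemma cube_substX : cube_subst X = X ^+ 3.
Proof. by apply/fpsP => n; rewrite coef_fpsXn cube_substE /=;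
    have [/dvdnP[k ->]|] := boolP (3 %| n)%N;
    [rewrite mulnK // (eqn_pmul2r (m := 3) (n2 := 1))|case: eqP => // ->]. Qed.

Lemma cube_substXn k : cube_subst (X ^+ k) = X ^+ (3 * k).
Proof. by rewrite rmorphXn /= cube_substX exprM. Qed.

Lemma eqmod_cube_subst N f g : fps_eqmod N f g -> fps_eqmod N (cube_subst f)
    (cube_subst g).
Proof. by move=> fg n nN; rewrite !cube_substE; case: ifP => // _; apply: fg; apply:
    leq_ltn_trans nN; apply: leq_div. Qed.

Lemma cube_subst_qpoch m i : (0 < m)%N -> (0 < i)%N ->
  cube_subst (qpoch R m i) = qpoch R (3 * m) (3 * i).
Proof.
move=> m0 i0; apply: eq_from_eqmod => N; apply: (@eqmodW _ N.+1) => //.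
apply: eqmod_trans (eqmod_cube_subst (eqmod_qpoch _ m0 i0)) _.
apply: eqmod_trans _ (eqmod_sym (@eqmod_qpoch R (3 * m) (3 * i) N _ _));
    rewrite ?muln_gt0 //.
rewrite rmorph_prod; apply: eqmod_prod => j _.
by rewrite rmorphB rmorph1 /= cube_substXn mulnDr mulnA.
Qed.

Lemma coef_trisection u0 u1 u2 n :
  let f := cube_subst u0 + X * cube_subst u1 + X ^+ 2 * cube_subst u2 in
  [/\ f (3 * n)%N = u0 n, f (3 * n).+1 = u1 n & f (3 * n).+2 = u2 n].
Proof.
have c0 (u : fps R) k : cube_subst u (3 * k)%N =
    u k by rewrite cube_substE dvdn_mulr // mulKn.
have c1 (u : fps R) k : cube_subst u (3 * k).+1 = 0 by rewrite cube_substE (_ :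
    (3 %| _)%N = false) //; lia.
have c2 (u : fps R) k : cube_subst u (3 * k).+2 = 0 by rewrite cube_substE (_ :
    (3 %| _)%N = false) //; lia.
have X0 f : (X * f) 0%N = 0 by rewrite coef_fpsMX.
have XS f k : (X * f) k.+1 = f k by rewrite coef_fpsMX.
have X3 u k : (X * cube_subst u) (3 * k)%N = 0.
  by case: k => [|k]; rewrite ?X0 // mulnS !addSn add0n XS c2.
have XX3 u k : (X * (X * cube_subst u)) (3 * k)%N = 0.
  by case: k => [|k]; rewrite ?X0 // mulnS !addSn add0n !XS c1.
by split; rewrite !coef_fpsD expr2 -mulrA ?X3 ?XX3 ?XS ?X3 ?c0 ?c1 ?c2 ?addr0 ?add0r.
Qed.

Lemma cube_substM f g : cube_subst (f * g) = cube_subst f * cube_subst g.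
Proof. exact: rmorphM. Qed.

Lemma cube_subst_exp f k : cube_subst (f ^+ k) = cube_subst f ^+ k.
Proof. exact: rmorphXn. Qed.

Lemma cube_substD f g : cube_subst (f + g) = cube_subst f + cube_subst g.
Proof. exact: rmorphD. Qed.

Lemma cube_substB f g : cube_subst (f - g) = cube_subst f - cube_subst g.
Proof. exact: rmorphB. Qed.

Lemma cube_substN f : cube_subst (- f) = - cube_subst f.
Proof. exact: rmorphN. Qed.

End CubeSubst.

(** * Trisections of the Euler product and of its cube *)

Section Jacobi.
Variable R : comUnitRingType.
Local Notation X := (fpsX R).
Local Notation isgn := (@theta_sign R).

Lemma theta_sign3 t : isgn (3 * t) = isgn t.
Proof.
rewrite /theta_sign -signr_odd -[in RHS]signr_odd; congr ((-1) ^+ (nat_of_bool _)).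
by rewrite abszM oddM.
Qed.

Lemma theta_sign3D t : isgn (3 * t + 1) = - isgn t.
Proof. by rewrite theta_signS theta_sign3. Qed.

Lemma theta_sign3B t : isgn (3 * t - 1) = - isgn t.
Proof. by have := theta_signS R (3 * t - 1); rewrite subrK theta_sign3 => ->;
    rewrite opprK. Qed.

Lemma theta_signN t : isgn (- t) = isgn t.
Proof. by rewrite /theta_sign abszN. Qed.

Lemma theta_expN t : theta_exp 3 1 (- t) = theta_exp 3 2 t.
Proof.
have := @theta_expE 3 1 (- t) isT; have := @theta_expE 3 2 t isT.
by move: (theta_exp _ _ _) (theta_exp _ _ _) => a b; lia.
Qed.

(** For [m = 1], [i = 0] the product contains [1 - z]. It vanishes at [z = 1], and its derivative
    there is minus the product of the remaining factors, which is the source of Jacobi's identity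
    for the cube. *)
Lemma bsum_theta_1_0 n : bsum n.+1 (theta_term R 1 0 n.+1) = 0.
Proof.
rewrite -horner_triple_prod_bsum // horner_triple_prod [X in _ * X]big_ord_recl.
by rewrite muln0 expr0 subrr mul0r mulr0.
Qed.

Lemma bsum_deriv_theta_1_0 n :
  bsum n.+1 (fun t => t%:~R * theta_term R 1 0 n.+1 t) =
  - (\prod_(j < n.+1) (1 - X ^+ (1 + 1 * j)) * \prod_(j < n) (1 - X ^+ (1 + 1 * j))).
Proof.
have := deriv_triple_prod_bsum R (isT : (0 <= 1)%N) n.+1.
rewrite bsum_theta_1_0 mulr0 add0r => <-.
rewrite /triple_prod derivM hornerD !hornerM [X in _ * X.[1]]big_ord_recl.
rewrite [X in _ * X^`().[1]]big_ord_recl derivM hornerD !hornerM muln0 expr0.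
have -> : (1 - (1 * 1)%:P * 'X : {poly fps R}).[1] = 0 by rewrite !hornerE subrr.
have -> : (1 - (1 * 1)%:P * 'X : {poly fps R})^`().[1] =
    - 1 by rewrite !derivE !hornerE.
rewrite !mul0r mulr0 add0r addr0 mulN1r mulrN !horner_prod; congr (- (_ * _)).
  by apply: eq_bigr => j _; rewrite !hornerE.
by apply: eq_bigr => j _; rewrite lift0 hornerD hornerN hornerM !hornerC hornerX mulr1
    mul1r.
Qed.

Lemma eqmod_theta_1_0 M n : (2 * M <= n)%N -> (0 < n)%N ->
  fps_eqmod M (bsum n (fun t => isgn t * X ^+ theta_exp 1 0 t)) 0.
Proof.
move=> Mn; case: n Mn => // n Mn _; apply: eqmod_sym.
have := @eqmod_theta R 1 0 isT (fun=> 1) M n.+1 isT Mn.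
rewrite (eq_bsum _ (fun t => mul1r _)) bsum_theta_1_0 mulr0.
by rewrite [X in fps_eqmod _ _ X](eq_bsum _ (fun t => mul1r _)).
Qed.

Lemma jacobi_cube M n : (2 * M <= n)%N -> (0 < n)%N ->
  fps_eqmod M (bsum n (fun t => t%:~R * (isgn t *
      X ^+ theta_exp 1 0 t))) (- qpoch R 1 1 ^+ 3).
Proof.
move=> Mn; case: n Mn => // n Mn _; apply: eqmod_sym.
apply: eqmod_trans _ (@eqmod_theta R 1 0 isT (fun t => t%:~R) M n.+1 isT Mn).
rewrite bsum_deriv_theta_1_0 mulrN; apply: eqmodN; rewrite !exprS expr0 mulr1.
by do 2?[apply: eqmodM => //]; apply: (eqmodW _ (eqmod_qpoch _ _ _)) => //; lia.
Qed.

End Jacobi.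

(* The sum of the Kronecker symbols [(d | 3)] over the divisors [d] of [n]. *)
Definition kronecker3_sum (n : nat) : int :=
  \sum_(j < n) ((3 * j + 1 %| n)%N%:Z - (3 * j + 2 %| n)%N%:Z).

Lemma kronecker3_sum_widen n N : (n <= N)%N ->
  kronecker3_sum n = \sum_(j < N) ((3 * j + 1 %| n)%N%:Z - (3 * j + 2 %| n)%N%:Z).
Proof.
move=> nN; rewrite -(subnKC nN) big_split_ord /= [X in _ = _ + X]big1 ?addr0 // => j _.
move: (nat_of_ord j) => {}j; have [->|n0] := posnP n; first by rewrite !dvdn0 subrr.
by rewrite !gtnNdvd ?subrr //; lia.
Qed.

Definition aser : fps int := locked (Fps (fun n => (n == 0%N)%:R + 6 *
    kronecker3_sum n)).

Lemma coef_aser n : aser n = (n == 0%N)%:R + 6 * kronecker3_sum n.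
Proof. by rewrite /aser -lock. Qed.

Local Notation X := (fpsX int).
Local Notation E k := (qpoch int k k).
Local Notation isgn := (@theta_sign int).

Lemma aser_lambert n : fps_eqmod n.+1 (1 + 6%:R * lambert int 3 2 n) aser.
Proof.
move=> k kn; rewrite coef_fpsD coef_fps1 coef_fps_natM coef_aser; congr (_ + _ * _).
rewrite (@kronecker3_sum_widen _ n) // /lambert coef_fps_sum.
apply: eq_bigr => j _; rewrite coef_fpsD coef_fpsN.
(* The correction at [k = 0] is the same for every [d] and cancels between the two halves of a
   Lambert term. *)
have H d : (0 < d)%N -> (X ^+ d * fps_geom int d) k = (d %| k)%N%:Z - (k == 0%N)%:Z.
  move=> d0; rewrite coef_fpsMXn; have [dk|kd] := leqP d k.
    have k0 : (k == 0%N) = false by apply: gtn_eqF; apply: leq_trans dk.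
    by rewrite coef_fps_geom // dvdn_subl // natz k0 subr0.
  by case: k kd {kn} => [|k] kd; rewrite ?dvdn0 // gtnNdvd.
have -> : (3 - 2 + 3 * j = 3 * j + 1)%N by lia.
have -> : (2 + 3 * j = 3 * j + 2)%N by lia.
rewrite (H (3 * j + 1)%N) ?addn1 // (H (3 * j + 2)%N) ?addn2 //.
by move: (_ %:Z) (_ %:Z) (_ %:Z) => a b e; rewrite opprB addrA subrK.
Qed.

(** Six times the derivative of the triple product for [m = 3], [i = 2], plus the triple product
    itself: the product is [E 1], and its logarithmic derivative is the Lambert series in [a]. *)
Lemma euler_aser M n : (2 * M <= n)%N ->
  fps_eqmod M (bsum n (fun t => (6 * t + 1)%:~R * (isgn t *
      X ^+ theta_exp 3 2 t))) (E 1 * aser).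
Proof.
move=> Mn; apply: eqmod_sym.
have -> : E 1 = E 3 * (qpoch int 3 1 * qpoch int 3 2) by rewrite (qpoch_trisect int (m
    := 1) (i := 1)) //; ring.
have H1 := @triple_product int 3 2 isT M n isT isT Mn.
have H2 := @triple_product_deriv int 3 2 isT M n isT isT Mn.
rewrite (@eq_bsum _ n _ (fun t => 6%:R * (t%:~R * (isgn t * X ^+ theta_exp 3 2 t)) +
    isgn t * X ^+ theta_exp 3 2 t)); last first.
  by move=> t; rewrite rmorphD rmorphM /= mulrDl mul1r mulrA.
rewrite bsumD bsumZ; apply: eqmod_trans _ (eqmodD (eqmodM (@eqmod_refl _ _ _) H2) H1).
apply: eqmod_trans (eqmodM (@eqmod_refl _ _ _) (eqmod_sym (eqmodW _ (@aser_lambert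
    n)))) _; first by lia.
by move=> k _; congr (fps_coef _ k); ring.
Qed.

Lemma theta_exp_1_0_3 t : theta_exp 1 0 (3 * t) = (3 * theta_exp 3 1 t)%N.
Proof.
have := @theta_expE 1 0 (3 * t) isT; have := @theta_expE 3 1 t isT.
move: (theta_exp _ _ _) (theta_exp _ _ _) => a b; lia.
Qed.

Lemma theta_exp_1_0_3D t : theta_exp 1 0 (3 * t + 1) = (3 * theta_exp 3 2 t)%N.
Proof.
have := @theta_expE 1 0 (3 * t + 1) isT; have := @theta_expE 3 2 t isT.
move: (theta_exp _ _ _) (theta_exp _ _ _) => a b; lia.
Qed.

Lemma theta_exp_1_0_3B t : theta_exp 1 0 (3 * t - 1) = (1 + 3 * (3 *
    theta_exp 1 0 t))%N.
Proof.
have := @theta_expE 1 0 (3 * t - 1) isT; have := @theta_expE 1 0 t isT.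
move: (theta_exp _ _ _) (theta_exp _ _ _) => a b; lia.
Qed.

Lemma theta_exp_3_2_3 t : theta_exp 3 2 (3 * t) = (3 * theta_exp 9 5 t)%N.
Proof.
have := @theta_expE 3 2 (3 * t) isT; have := @theta_expE 9 5 t isT.
move: (theta_exp _ _ _) (theta_exp _ _ _) => a b; lia.
Qed.

Lemma theta_exp_3_2_3D t : theta_exp 3 2 (3 * t + 1) = (2 + 3 * theta_exp 9 8 t)%N.
Proof.
have := @theta_expE 3 2 (3 * t + 1) isT; have := @theta_expE 9 8 t isT.
move: (theta_exp _ _ _) (theta_exp _ _ _) => a b; lia.
Qed.

Lemma theta_exp_3_2_3B t : theta_exp 3 2 (3 * t - 1) = (1 + 3 * theta_exp 9 2 t)%N.
Proof.
have := @theta_expE 3 2 (3 * t - 1) isT; have := @theta_expE 9 2 t isT.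
move: (theta_exp _ _ _) (theta_exp _ _ _) => a b; lia.
Qed.

Lemma cube_subst_bsum n (F : int -> fps int) :
  cube_subst (bsum n F) = bsum n (fun t => cube_subst (F t)).
Proof. exact: rmorph_sum. Qed.

Lemma theta_sign_int t : isgn t = ((-1) ^+ `|t|%N)%:~R.
Proof. by rewrite /theta_sign rmorphXn rmorphN1. Qed.

Lemma cube_subst_isgn t : cube_subst (isgn t) = isgn t.
Proof. by rewrite theta_sign_int rmorph_int. Qed.

Lemma cube_subst_sterm t k : cube_subst (isgn t * X ^+ k) = isgn t * X ^+ (3 * k).
Proof. by rewrite rmorphM /= cube_subst_isgn cube_substXn. Qed.

Lemma cube_subst_intM (c : int) (f : fps int) : cube_subst (c%:~R * f) = c%:~R *
    cube_subst f.
Proof. by rewrite rmorphM /= rmorph_int. Qed.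

Lemma cube_subst_natM k (f : fps int) : cube_subst (k%:R * f) = k%:R * cube_subst f.
Proof. by rewrite rmorphM /= rmorph_nat. Qed.

(** Jacobi's sum is split by [t] modulo 3. Replacing [t] by [- t] in the class of [3 t] gives it the
    exponents of the class of [3 t + 1], and the weights add up to [6 t + 1], as in [euler_aser].
    The class of [3 t - 1] reproduces Jacobi's sum in [q ^ 9], up to the sum [S0], which is zero. *)
Lemma euler_cube_trisection :
  E 1 ^+ 3 = cube_subst (E 1 * aser) - 3%:R * X * cube_subst (cube_subst (E 1 ^+ 3)).
Proof.
apply: eq_from_eqmod => M; pose n := (2 * M).+1.
have Mn : (2 * M <= n)%N by rewrite /n.
have M3n : (2 * M <= (3 * n).+1)%N by rewrite /n; lia.
rewrite -[E 1 ^+ 3 in X in fps_eqmod _ X _]opprK.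
apply: eqmod_trans (eqmodN (eqmod_sym (jacobi_cube int M3n isT))) _.
rewrite bsum_trisect.
pose S1 := bsum n (fun t => (6 * t + 1)%:~R * (isgn t * X ^+ theta_exp 3 2 t)).
pose S2 := bsum n (fun t => t%:~R * (isgn t * X ^+ theta_exp 1 0 t)).
pose S0 := bsum n (fun t => isgn t * X ^+ theta_exp 1 0 t).
have H : - bsum n (fun t => (3 * t)%:~R * (isgn (3 * t) * X ^+ theta_exp 1 0 (3 * t))
   + (3 * t + 1)%:~R * (isgn (3 * t + 1) * X ^+ theta_exp 1 0 (3 * t + 1))
   + (3 * t - 1)%:~R * (isgn (3 * t - 1) * X ^+ theta_exp 1 0 (3 * t - 1))) =
  cube_subst S1 + X * cube_subst (cube_subst (3%:R * S2 - S0)).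
  rewrite !bsumD -[X in - (X + _ + _)]bsum_opp -!bsumD -bsumN /S1 /S2 /S0.
  rewrite -bsumZ -[- bsum n _]bsumN -bsumD !cube_subst_bsum -bsumZ -bsumD.
  apply: eq_bsum => t; rewrite mulrN theta_exp_1_0_3D theta_exp_1_0_3B theta_sign3D
      theta_sign3B.
  rewrite -[- (3 * t)]mulrN theta_sign3 theta_signN theta_exp_1_0_3 theta_expN.
  rewrite cube_subst_intM cube_subst_sterm [cube_subst (_ -
      _)]rmorphB /= [cube_subst (_ - _)]rmorphB /=.
  rewrite !cube_subst_natM !cube_subst_intM !cube_subst_sterm exprD expr1.
  have -> : (3 * - t)%:~R = - (3%:R * t%:~R) :> fps int by rewrite mulrN rmorphN
      rmorphM.
  have -> : (3 * t + 1)%:~R = 3%:R * t%:~R + 1 :> fps int by rewrite rmorphD rmorphM.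
  have -> : (3 * t - 1)%:~R = 3%:R * t%:~R - 1 :> fps int by rewrite rmorphB rmorphM.
  have -> : (6 * t + 1)%:~R = 6%:R * t%:~R + 1 :> fps int by rewrite rmorphD rmorphM.
  ring.
rewrite H; apply: eqmodD; first by apply: eqmod_cube_subst; apply: euler_aser.
rewrite -mulrN -mulrA mulrCA; apply: eqmodM => //.
have -> : 3%:R * - cube_subst (cube_subst (E 1 ^+ 3)) = cube_subst (cube_subst (3%:R *
    (- E 1 ^+ 3) - 0)).
  by rewrite subr0 !cube_subst_natM !rmorphN.
do 2!apply: eqmod_cube_subst; apply: eqmodB; last exact: eqmod_theta_1_0.
by apply: eqmodM => //; apply: jacobi_cube.
Qed.

Lemma euler_trisection :
  E 1 = cube_subst (E 9 * (qpoch int 9 4 * qpoch int 9 5))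
      - X * cube_subst (E 9 * (qpoch int 9 7 * qpoch int 9 2))
      - X ^+ 2 * cube_subst (E 9 * (qpoch int 9 1 * qpoch int 9 8)).
Proof.
apply: eq_from_eqmod => M; pose n := (2 * M)%N.
have M3n : (2 * M <= (3 * n).+1)%N by rewrite /n; lia.
have -> : E 1 = E 3 * (qpoch int 3 1 * qpoch int 3 2) by rewrite (qpoch_trisect int (m
    := 1) (i := 1)) //; ring.
apply: eqmod_trans (@triple_product int 3 2 isT M _ isT isT M3n) _.
have H i (i0 : (0 < i)%N) (i9 : (i < 9)%N) :=
  eqmod_cube_subst (eqmod_sym (@triple_product int 9 i (ltnW i9) M n i0 i9 (leqnn _))).
apply: eqmod_trans _ (eqmodB (eqmodB (H 5 isT isT) (eqmodM (@eqmod_refl _ _ _) (H 2 isT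
    isT)))
   (eqmodM (@eqmod_refl _ _ _) (H 8 isT isT))).
rewrite bsum_trisect !cube_subst_bsum -!bsumZ -!bsumN -!bsumD.
apply: eqmod_bsum => t _ k _; congr (fps_coef _ k).
rewrite theta_sign3 theta_sign3D theta_sign3B theta_exp_3_2_3 theta_exp_3_2_3D
    theta_exp_3_2_3B.
by rewrite !rmorphM /= cube_subst_isgn !cube_substXn !exprD; ring.
Qed.

(** * The theta series of the Eisenstein integers *)

Definition eis_norm (x y : int) : nat := absz (x ^+ 2 + x * y + y ^+ 2).

Lemma eis_normE x y : (eis_norm x y)%:Z = x ^+ 2 + x * y + y ^+ 2.
Proof. by rewrite /eis_norm; nia. Qed.

Lemma cube_roots_prod (S : comNzRingType) (w a t : S) : w * w = - 1 - w ->
  (a - t) * ((w * a - t) * (w * w * a - t)) = a ^+ 3 - t ^+ 3.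
Proof.
move=> w2; rewrite w2.
transitivity ((a - t) * (- (w + w * w) * a ^+ 2 + t * a + t ^+ 2)); first by ring.
by rewrite w2; ring.
Qed.

Section ConstantTerm.
Variable R : comUnitRingType.
Variable W : fps R.
Hypothesis W2 : W * W = - 1 - W.
Local Notation X := (fpsX R).
Local Notation isgn := (@theta_sign R).
Local Notation T := (triple_prod 1 0).

(** The factors at [z], [w z] and [w ^ 2 z] multiply to differences of cubes, so the result is again
    a triple product, now in [q ^ 3] and [z ^ 3]. *)
Lemma triple_prod_cube n :
  T 1 n n * (T W n n * T (W * W) n n) = triple_prod 3 0 (1 : fps R) n n \Po 'X^3.
Proof.
have w2 : W%:P * W%:P = - 1 - W%:P by rewrite -polyCM W2 polyCB polyCN.
rewrite /triple_prod comp_polyM !(rmorph_prod (comp_poly 'X^3)) /=.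
rewrite [X in _ * X = _]mulrACA [LHS]mulrACA; congr (_ * _); rewrite -!big_split /=.
  apply: eq_bigr => j _; rewrite comp_polyB comp_polyM !comp_polyC comp_polyX.
  have -> : (3 - 0 + 3 * j = (1 - 0 + 1 * j) * 3)%N by lia.
  rewrite exprM; move: (X ^+ (1 - 0 + 1 * j)) => x.
  by rewrite polyC_exp polyCM !mul1r cube_roots_prod.
apply: eq_bigr => j _; rewrite comp_polyB comp_polyM !comp_polyC comp_polyX.
have -> : (0 + 3 * j = (0 + 1 * j) * 3)%N by lia.
rewrite exprM; move: (X ^+ (0 + 1 * j)) => x; rewrite !mul1r.
have := @cube_roots_prod _ W%:P (x%:P * 'X) 1 w2.
rewrite polyC_exp !polyCM -exprMn expr1n -!mulrA.
move: ((_ ^+ 3) : {poly fps R}) => y H.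
by rewrite -[RHS]opprB -H; ring.
Qed.

Lemma theta_signD x y : isgn (x + y) = isgn x * isgn y.
Proof.
rewrite /theta_sign -exprD -signr_odd -[in RHS]signr_odd;
    congr ((-1) ^+ (nat_of_bool _)).
rewrite oddD; lia.
Qed.

(** For [x + y + z = 0] the linear parts of the exponents cancel and half the sum of the squares is
    the norm. *)
Lemma eis_norm_theta_exp x y :
  eis_norm x y = (theta_exp 1 0 (- x - y) + (theta_exp 1 0 x + theta_exp 1 0 y))%N.
Proof.
have := @theta_expE 1 0 x isT; have := @theta_expE 1 0 y isT;
    have := @theta_expE 1 0 (- x - y) isT.
by have := eis_normE x y; move: (theta_exp _ _ _) (theta_exp _ _ _) (theta_exp _ _ _)
    => a b c; nia.
Qed.

(** The coefficient of [z ^ (3 n)] in [triple_prod_cube], which is the constant term once the three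
    factors [z ^ n] are removed. The multiple by [k + l <= 3 * n] discards indices at which the
    subtraction would be truncated. *)
Lemma triple_prod_cube_coef n :
  \sum_(k < (2 * n).+1) \sum_(l < (2 * n).+1)
    ((T (1 : fps R) n n)`_(3 * n - (k + l)) *+ (k + l <= 3 * n)%N
      * ((T W n n)`_k * (T (W * W) n n)`_l)) = gauss_bin (X ^+ 3) (n + n) n.
Proof.
have tE (V : fps R) : T V n n = \sum_(k < (2 * n).+1) (T V n n)`_k *: 'X^k.
  rewrite -poly_def; apply/polyP => k; rewrite coef_poly; case: ltnP => // nk.
  by apply: (leq_sizeP _ _ (size_triple_prod _ _ _)).
have := congr1 (fun p : {poly fps R} => p`_(3 * n)) (triple_prod_cube n).
rewrite /= coef_comp_poly_Xn // dvdn_mulr // mulKn // coef_triple_prod // subrr.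
rewrite (_ : theta_exp 3 0 0 = 0%N) // expr1n /theta_sign absz0 !expr0 !mul1r => <-.
rewrite [in RHS](tE W) [in RHS](tE (W * W)) mulr_suml mulr_sumr coef_sum.
apply: eq_bigr => k _; rewrite mulr_sumr mulr_sumr coef_sum; apply: eq_bigr => l _.
rewrite -scalerAl -!scalerAr scalerA coefZ -exprD coefMXn mulrC; congr (_ * _).
by rewrite ltnNge; case: leqP.
Qed.

Lemma eis_norm_lt x y M : (eis_norm x y < M)%N -> (`|x| <= M)%N /\ (`|y| <= M)%N.
Proof.
have := eis_normE x y; move: (eis_norm x y) => N NE NM; split.
  have H : 3 * x ^+ 2 <= 4 * N%:Z by rewrite NE; have := sqr_ge0 (x + 2 * y); lra.
  by nia.
have H : 3 * y ^+ 2 <= 4 * N%:Z by rewrite NE; have := sqr_ge0 (y + 2 * x); lra.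
by nia.
Qed.

Lemma eis_normC x y : eis_norm x y = eis_norm y x.
Proof. by rewrite /eis_norm; congr absz; ring. Qed.

Lemma eis_norm_rot x y : eis_norm x y = eis_norm (- x - y) y.
Proof. by rewrite /eis_norm; congr absz; ring. Qed.

(* The constant term in [z] of the triple products at [z], [w z], [w ^ 2 z]. *)
Lemma trinomial_theta n M : (2 * M <= n)%N ->
  fps_eqmod M (qpoch R 1 1 ^+ 3)
   (qpoch R 3 3 * \sum_(k < (2 * n).+1) \sum_(l < (2 * n).+1)
       W ^+ (k + 2 * l) * X ^+ eis_norm (k%:Z - n%:Z) (l%:Z - n%:Z)).
Proof.
move=> Mn.
have H3 : fps_eqmod M (qpoch R 3 3 * gauss_bin (X ^+ 3) (n + n) n) 1 by apply:
    qpoch_gauss_bin; lia.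
rewrite -[qpoch R 1 1 ^+ 3]mulr1; apply:
    eqmod_trans (eqmodM (@eqmod_refl _ _ _) (eqmod_sym H3)) _.
rewrite mulrCA; apply: eqmodM => //; rewrite -triple_prod_cube_coef mulr_sumr.
apply: eqmod_sum => k _; rewrite mulr_sumr; apply: eqmod_sum => l _.
have kn := ltn_ord k; have ln := ltn_ord l; set x := k%:Z - n%:Z; set y := l%:Z - n%:Z.
(* For norm at least [M] both sides vanish modulo [X ^ M]. Otherwise [x], [y] and [- x - y] are at
   most [M] in absolute value, and each of the three binomials cancels one factor [E_1]. *)
have [Q0|Q0] := leqP M (eis_norm x y).
  have XQ : fps_eqmod M (X ^+ eis_norm x y) 0 by apply: eqmod_Xn0.
  apply: eqmod_trans _ (eqmod_sym (eqmodM (@eqmod_refl _ _ _) XQ)); rewrite mulr0.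
  have [kl|] := leqP (k + l) (3 * n); last by rewrite mulr0n mul0r mulr0.
  rewrite mulr1n !coef_triple_prod //.
  have -> : (3 * n - (k + l))%:Z - n%:Z = - x - y by rewrite /x /y; lia.
  rewrite eis_norm_theta_exp !exprD in XQ.
  rewrite -/x -/y expr1n mul1r.
  rewrite (_ : _ * (_ * _) = (X ^+ theta_exp 1 0 (- x - y) * (X ^+ theta_exp 1 0 x *
      X ^+ theta_exp 1 0 y)) *
    (qpoch R 1 1 ^+ 3 * (W ^+ k * (W * W) ^+ l) * gauss_bin (X ^+ 1) (n + n) (3 * n -
        (k + l)) *
     gauss_bin (X ^+ 1) (n + n) k * gauss_bin (X ^+ 1) (n + n) l * (isgn (- x - y) *
         isgn x * isgn y))); last by ring.
  by apply: eqmod_trans (eqmodM XQ (@eqmod_refl _ _ _)) _; rewrite mul0r.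
have [xM yM] := eis_norm_lt Q0.
have [zM _] : (`|(- x - y)%R| <= M)%N /\ (`|y| <= M)%N by apply: eis_norm_lt;
    rewrite -eis_norm_rot.
have kl : (k + l <= 3 * n)%N by rewrite /x /y in zM; lia.
rewrite kl mulr1n !coef_triple_prod // expr1n mul1r.
have -> : (3 * n - (k + l))%:Z - n%:Z = - x - y by rewrite /x /y; lia.
rewrite -/x -/y eis_norm_theta_exp.
have G j : (M <= j)%N -> (j + M <= n + n)%N -> fps_eqmod M (qpoch R 1 1 *
    gauss_bin (X ^+ 1) (n + n) j) 1.
  by move=> Mj jn; apply: qpoch_gauss_bin.
have G1 := G (3 * n - (k + l))%N; have G2 := G k; have G3 := G l.
have {G G1}G1 : fps_eqmod M (qpoch R 1 1 * gauss_bin (X ^+ 1) (n + n) (3 * n - (k +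
    l))) 1.
  by apply: G1; rewrite /x /y in zM; lia.
have {}G2 : fps_eqmod M (qpoch R 1 1 * gauss_bin (X ^+ 1) (n + n) k) 1.
  by apply: G2; rewrite /x in xM; lia.
have {}G3 : fps_eqmod M (qpoch R 1 1 * gauss_bin (X ^+ 1) (n + n) l) 1.
  by apply: G3; rewrite /y in yM; lia.
have S1 : isgn (- x - y) * isgn x * isgn y = 1.
  by rewrite -!theta_signD (_ : - x - y + x + y = 0) ?/theta_sign ?expr0 //; ring.
have := eqmodM (@eqmod_refl _ M (W ^+ (k + 2 * l) * X ^+ (theta_exp 1 0 (- x - y) +
    (theta_exp 1 0 x + theta_exp 1 0 y))))
   (eqmodM G1 (eqmodM G2 G3)).
rewrite !mulr1; apply: eqmod_trans => j _; congr (fps_coef _ j).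
have EW : W ^+ (k + 2 * l) = W ^+ k * (W * W) ^+ l by rewrite exprD exprM expr2.
by rewrite -[W ^+ (k + 2 * l)]mulr1 -S1 EW !exprD; ring.
Qed.

End ConstantTerm.

(** * Change of the coefficient ring *)

Section MapFps.
Variables (R S : comUnitRingType) (phi : {rmorphism R -> S}).

Definition fps_map (f : fps R) : fps S := Fps (fun n => phi (f n)).

Fact fps_map_zmod_morphism : zmod_morphism fps_map.
Proof. by move=> f g; apply/fpsP => n; rewrite /= rmorphB. Qed.

Fact fps_map_monoid_morphism : monoid_morphism fps_map.
Proof.
split=> [|f g]; apply/fpsP => n; first by rewrite /= rmorph_nat.
by rewrite /= rmorph_sum; apply: eq_bigr => i _; rewrite rmorphM.
Qed.

HB.instance Definition _ := GRing.isZmodMorphism.Build (fps R) (fps S) fps_map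
    fps_map_zmod_morphism.
HB.instance Definition _ := GRing.isMonoidMorphism.Build (fps R) (fps S) fps_map
    fps_map_monoid_morphism.

Lemma fps_mapX : fps_map (fpsX R) = fpsX S.
Proof. by apply/fpsP => n; rewrite /= rmorph_nat. Qed.

Lemma eqmod_fps_map N f g : fps_eqmod N f g -> fps_eqmod N (fps_map f) (fps_map g).
Proof. by move=> fg n nN /=; rewrite fg. Qed.

Lemma fps_map_qpoch m i : (0 < m)%N -> (0 < i)%N -> fps_map (qpoch R m i) = qpoch S m i.
Proof.
move=> m0 i0; apply: eq_from_eqmod => N; apply: (@eqmodW _ N.+1) => //.
apply: eqmod_trans (eqmod_fps_map (eqmod_qpoch _ m0 i0)) _.
apply: eqmod_trans _ (eqmod_sym (eqmod_qpoch _ m0 i0)).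
rewrite rmorph_prod; apply: eqmod_prod => j _.
by rewrite rmorphB rmorph1 rmorphXn /= fps_mapX.
Qed.

End MapFps.

Section Const.
Variable R : comUnitRingType.

Definition fps_const (c : R) : fps R := Fps (fun n => if n is 0 then c else 0).

Lemma coef_fps_constM c f n : (fps_const c * f) n = c * f n.
Proof.
rewrite coef_fpsM big_ord_recl subn0 big1 ?addr0 // => i _.
by rewrite /= mul0r.
Qed.

Lemma coef_fps_constXM c k f n : (fps_const c ^+ k * f) n = c ^+ k * f n.
Proof. by elim: k n => [|k IH] n; rewrite ?mul1r // !exprS -!mulrA coef_fps_constM IH.
    Qed.

End Const.

(** * Eisenstein integers of a given norm *)

Definition int_box (n : nat) : seq int := [seq k%:Z - n%:Z | k <- iota 0 (2 * n).+1].

Arguments int_box : simpl never.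

Lemma mem_int_box n x : (x \in int_box n) = (`|x| <= n)%N.
Proof.
apply/mapP/idP => [[k]|xn]; first by rewrite mem_iota => kn ->; lia.
by exists (absz (x + n%:Z)); rewrite ?mem_iota; lia.
Qed.

Lemma int_box_uniq n : uniq (int_box n).
Proof. by rewrite map_inj_uniq ?iota_uniq // => x y; lia. Qed.

Lemma big_int_box (V : nmodType) n (F : int -> V) :
  \sum_(k < (2 * n).+1) F (k%:Z - n%:Z) = \sum_(x <- int_box n) F x.
Proof. by rewrite -(big_mkord xpredT (fun k => F (k%:Z -
    n%:Z))) /index_iota subn0 big_map. Qed.

(** The box of radius [n] makes the set of solutions a finite list; it contains all of them as soon
    as [N < n]. *)
Definition eis_sphere (n N : nat) : seq (int * int) :=
  [seq p <- [seq (x, y) | x <- int_box n, y <- int_box n] | eis_norm p.1 p.2 == N].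

Lemma big_eis_sphere (V : nmodType) n N (F : int * int -> V) :
  \sum_(p <- eis_sphere n N) F p =
  \sum_(k < (2 * n).+1) \sum_(l < (2 * n).+1)
    if eis_norm (k%:Z - n%:Z) (l%:Z - n%:Z) == N then F (k%:Z - n%:Z, l%:Z -
        n%:Z) else 0.
Proof.
rewrite (big_int_box n (fun x => \sum_(l < (2 * n).+1)
    if eis_norm x (l%:Z - n%:Z) == N then F (x, l%:Z - n%:Z) else 0)).
rewrite /eis_sphere big_filter big_mkcond.
rewrite [LHS]big_allpairs.
by apply: eq_bigr => x _; rewrite -(big_int_box n (fun y =>
    if eis_norm x y == N then F (x, y) else 0)).
Qed.

Lemma mem_eis_sphere n N p : (N < n)%N -> (p \in eis_sphere n N) =
    (eis_norm p.1 p.2 == N).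
Proof.
move=> Nn; rewrite mem_filter; case: eqP => //= pN; case: p pN => x y /= pN.
have [xN yN] := @eis_norm_lt x y N.+1 ltac:(by rewrite pN).
apply/idP/(@allpairsP int int (int * int)%type pair (int_box n) (int_box n));
    exists (x, y).
by rewrite !mem_int_box; split=> //; apply: leq_trans Nn.
Qed.

Lemma eis_sphere_uniq n N : uniq (eis_sphere n N).
Proof.
apply: filter_uniq; apply: allpairs_uniq; try exact: int_box_uniq.
by move=> [a b] [c d] _ _ [-> ->].
Qed.

Definition eis_count N := size (eis_sphere N.+1 N).

Lemma eis_sphere_size n N : (N < n)%N -> size (eis_sphere n N) = eis_count N.
Proof.
move=> Nn; apply: perm_size; apply: uniq_perm; rewrite ?eis_sphere_uniq // => p.
by rewrite !mem_eis_sphere.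
Qed.

Lemma eis_norm_mod3 x y : exists k, (x - y) ^+ 2 = (eis_norm x y)%:Z + 3 * k.
Proof. by exists (- x * y); rewrite eis_normE; ring. Qed.

Lemma eis_norm_dvd3 x y : (3 %| eis_norm x y)%N -> exists k : int, x = y + 3 * k.
Proof.
move=> d3; have [k] := eis_norm_mod3 x y; move: d3; move: (eis_norm x y) => N d3 E.
exists ((x - y) %/ 3)%Z; have := divz_eq (x - y) 3; have := modz_ge0 (x - y) (isT :
    3 != 0 :> int).
have := ltz_pmod (x - y) (isT : 0 < 3 :> int).
move: (_ %/ _)%Z (_ %% _)%Z => q r r3 r0 E2; rewrite E2 in E.
have [r_|[r_|r_]] : r = 0 \/ r = 1 \/ r = 2 by lia.
- by rewrite r_ in E2; lia.
- have : 9 * q ^+ 2 + 6 * q + 1 = N%:Z + 3 * k by rewrite -E r_; ring.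
  by clear E; lia.
- have : 9 * q ^+ 2 + 12 * q + 4 = N%:Z + 3 * k by rewrite -E r_; ring.
  by clear E; lia.
Qed.

Lemma eis_norm_neq2 x y : (eis_norm x y %% 3 != 2)%N.
Proof.
have [k] := eis_norm_mod3 x y; move: (eis_norm x y) => N E.
have := divz_eq (x - y) 3; have := modz_ge0 (x - y) (isT : 3 != 0 :> int).
have := ltz_pmod (x - y) (isT : 0 < 3 :> int).
move: (_ %/ _)%Z (_ %% _)%Z => q r r3 r0 E2; rewrite E2 in E.
have [r_|[r_|r_]] : r = 0 \/ r = 1 \/ r = 2 by lia.
- have : 9 * q ^+ 2 = N%:Z + 3 * k by rewrite -E r_; ring.
  by clear E; lia.
- have : 9 * q ^+ 2 + 6 * q + 1 = N%:Z + 3 * k by rewrite -E r_; ring.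
  by clear E; lia.
- have : 9 * q ^+ 2 + 12 * q + 4 = N%:Z + 3 * k by rewrite -E r_; ring.
  by clear E; lia.
Qed.

(* Multiplication by an element of norm 3. *)
Lemma eis_count3 N : eis_count (3 * N) = eis_count N.
Proof.
pose n := (3 * N).+1; have nN : (N < n)%N by rewrite /n; lia.
rewrite -(eis_sphere_size nN) /eis_count -/n.
rewrite -(size_map (fun p : int * int => (p.1 - p.2, p.1 + 2 * p.2)) (eis_sphere n N)).
apply: perm_size; apply: uniq_perm; rewrite ?eis_sphere_uniq //.
  by rewrite map_inj_uniq ?eis_sphere_uniq // => -[a b] [c d] [] /= ? ?; congr (_, _);
      lia.
move=> [u v]; rewrite mem_eis_sphere //=.
have norm3 x y : eis_norm (x - y) (x + 2 * y) = (3 * eis_norm x y)%N.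
  by apply/eqP; rewrite -eqz_nat PoszM !eis_normE; apply/eqP; ring.
apply/eqP/mapP => [uv | [[x y]]]; last first.
  by rewrite mem_eis_sphere //= => /eqP xy [-> ->]; rewrite norm3 xy.
have [k uvk] := @eis_norm_dvd3 u v ltac:(by rewrite uv dvdn_mulr).
exists (u - k, - k); last by rewrite /=; congr (_, _); lia.
rewrite mem_eis_sphere //=; apply/eqP.
have E1 : u - k - - k = u by ring.
have E2 : u - k + 2 * - k = v by rewrite uvk; ring.
have := norm3 (u - k) (- k); rewrite E1 E2 uv => /eqP.
by rewrite eqn_pmul2l // => /eqP.
Qed.

(* The series [c] of the Borweins without its factor [q ^ (1 / 3)]. *)
Definition cser : fps int := locked (3%:R * qpoch int 3 3 ^+ 3 / qpoch int 1 1).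

Lemma E_unit k : (0 < k)%N -> E k \is a GRing.unit.
Proof. by move=> k0; apply: qpoch_unit. Qed.

Lemma cserE : E 1 * cser = 3%:R * E 3 ^+ 3.
Proof. by rewrite /cser -lock mulrC divrK // E_unit. Qed.

Lemma cube_subst_E1 : cube_subst (E 1) = E 3.
Proof. by rewrite cube_subst_qpoch // muln1. Qed.

Lemma euler_cube : E 1 ^+ 3 = E 3 * (cube_subst aser - X * cube_subst cser).
Proof.
have H : E 3 * cube_subst cser = 3%:R * cube_subst (cube_subst (E 1 ^+ 3)).
  by rewrite -{1}cube_subst_E1 -cube_substM cserE cube_subst_natM !cube_subst_exp
      cube_subst_E1.
rewrite euler_cube_trisection cube_substM cube_subst_E1 mulrBr; congr (_ - _).
by rewrite [RHS]mulrCA H; ring.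
Qed.

Lemma cube_root1_sum (F : fieldType) (w : F) : 3.-primitive_root w -> w ^+ 2 = - 1 - w.
Proof.
move=> pw; have w3 := prim_expr_order pw.
have w1 : w != 1 by have := eq_prim_root_expr pw 1 0; rewrite expr1 expr0 => ->.
apply/eqP; rewrite -subr_eq0; have : (w - 1) * (w ^+ 2 - (- 1 - w)) = 0.
  by transitivity (w ^+ 3 - 1); [ring | rewrite w3 subrr].
by move/eqP; rewrite mulf_eq0 => /orP[|//]; rewrite (subr_eq0 w 1) (negbTE w1).
Qed.

(** The series of the Borweins [b = E_1^3 / E_3], computed in two ways: [euler_cube] and
    [trinomial_theta] have the same left side, and [E_3] cancels. The radius [2 * N.+1] is what
    [trinomial_theta] requires modulo [X ^ N.+1]. *)
Lemma bser_sphere (w : algC) N : 3.-primitive_root w ->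
  ((cube_subst aser - X * cube_subst cser) N)%:~R =
  \sum_(p <- eis_sphere (2 * N.+1) N) w ^ (p.1 + 2 * p.2).
Proof.
move=> pw; have w3 := prim_expr_order pw; have w2 := cube_root1_sum pw.
pose W := fps_const w; have W2 : W * W = - 1 - W.
  apply/fpsP => n; rewrite coef_fps_constM coef_fpsD !coef_fpsN coef_fps1.
  by case: n => [|n] /=; rewrite -?expr2 ?w2 ?mulr1n ?mulr0n ?mulr0 ?oppr0 ?addr0
      ?oppr0.
pose n := (2 * N.+1)%N; set b := _ - _.
have phiE k : (0 < k)%N -> fps_map (intr : int -> algC) (E k) = qpoch _ k k.
  by move=> k0; rewrite fps_map_qpoch.
have /(congr1 (fps_map (intr : int -> algC))) := euler_cube.
rewrite rmorphXn rmorphM /= !phiE // -/b => H.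
have := trinomial_theta W2 (leqnn n : (2 * N.+1 <= n)%N); rewrite H.
move=> /(eqmod_unit_cancel (qpoch_unit _ (isT : 0 < 3)%N (isT :
    0 < 3)%N)) /(_ N (ltnSn N)) HN.
have -> : (b N)%:~R = fps_map (intr : int -> algC) b N by [].
rewrite HN.
rewrite big_eis_sphere coef_fps_sum -/n; apply: eq_bigr => k _; rewrite coef_fps_sum.
set x := k%:Z - n%:Z.
apply: eq_bigr => l _; rewrite coef_fps_constXM coef_fpsXn eq_sym.
case: eqP => _; rewrite ?mulr1 ?mulr0 //.
have w0 : w != 0 by rewrite -unitfE -(unitrX_pos _ (isT : 0 < 3)%N) w3 unitr1.
(* Moving the indices to the centre of the box changes the exponent by a multiple of 3, which [w]
   ignores. *)
have -> : x + 2 * (l%:Z - n%:Z) = (k + 2 * l)%:Z - (3 * n)%:Z by rewrite /x; lia.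
by rewrite expfzDr // -exprnN -exprnP exprM w3 expr1n invr1 mulr1.
Qed.

Lemma coef_bser n (b := cube_subst aser - X * cube_subst cser) :
  b (3 * n)%N = aser n /\ b (3 * n).+1 = - cser n.
Proof.
have [h0 h1 _] := coef_trisection aser (- cser) 0 n.
have bE : b = cube_subst aser + X * cube_subst (- cser) + X ^+ 2 * cube_subst 0.
  by rewrite /b cube_substN rmorph0 mulr0 addr0 mulrN.
by rewrite bE h0 h1 coef_fpsN.
Qed.

(** At norm [3 n] one has [x = y] modulo 3, so every weight [w ^ (x + 2 y)] is 1 and [bser_sphere]
    counts; [eis_count3] then returns to norm [n]. *)
Lemma aser_count n : aser n = (eis_count n)%:Z.
Proof.
have [w pw] := @C_prim_root_exists 3 isT; have w3 : w ^ 3 = 1 := prim_expr_order pw.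
rewrite -eis_count3; have := bser_sphere (3 * n) pw; rewrite (coef_bser n).1.
rewrite big_seq (eq_bigr (fun=> 1)); last first.
  move=> [x y]; rewrite mem_eis_sphere; last by lia.
  move=> /= /eqP pN; have [k ->] := @eis_norm_dvd3 x y ltac:(by rewrite pN dvdn_mulr).
  by rewrite (_ : _ + _ = 3 * (y + k)) -?exprz_exp ?w3 ?exp1rz //; ring.
rewrite -big_seq big_const_seq count_predT iter_addr_0.
rewrite eis_sphere_size; last by lia.
by rewrite pmulrn => /intr_inj.
Qed.

(** At norm [3 n + 1], [x] and [y] differ modulo 3, so the weight is [w] or [w ^ 2], and exchanging
    [x] with [y] exchanges the two. Adding the sum to its mirror image turns every weight into
    [w + w ^ 2 = - 1]. *)
Lemma cser_count n : 2 * cser n = (eis_count (3 * n).+1)%:Z.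
Proof.
have [w pw] := @C_prim_root_exists 3 isT; have w3 : w ^ 3 = 1 := prim_expr_order pw.
have w2 := cube_root1_sum pw.
have wD3 z k : w ^ (z + 3 * k) = w ^ z.
  have w0 : w != 0 by rewrite -unitfE -(unitrX_pos _ (isT : 0 < 3)%N) [w ^+ 3]w3 unitr1.
  by rewrite expfzDr // -exprz_exp w3 exp1rz mulr1.
have H := bser_sphere (3 * n).+1 pw; rewrite (coef_bser n).2 in H.
set L := eis_sphere _ _ in H.
have HC : \sum_(p <- L) w ^ (p.1 + 2 * p.2) = \sum_(p <- L) w ^ (p.2 + 2 * p.1).
  rewrite -[RHS](big_map (fun p : int * int => (p.2, p.1)) xpredT (fun p => w ^ (p.1 +
      2 * p.2))).
  apply: perm_big; apply: uniq_perm; rewrite ?eis_sphere_uniq //.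
    by rewrite map_inj_uniq ?eis_sphere_uniq // => -[a b] [c d] [-> ->].
  move=> [x y]; rewrite mem_eis_sphere /=; last by lia.
  apply/idP/mapP => [xy | [[u v]]]; first by exists (y, x) => //;
      rewrite mem_eis_sphere /= 1?eis_normC //; lia.
  by rewrite mem_eis_sphere /= 1?eis_normC => [uv [-> ->] //|]; lia.
have : (- cser n)%:~R + (- cser n)%:~R = \sum_(p <- L) (- 1 : algC).
  rewrite {2}H HC H -big_split big_seq [RHS]big_seq; apply: eq_bigr => -[x y].
  rewrite mem_eis_sphere /=; last by lia.
  move=> /eqP xy; have [k] := eis_norm_mod3 x y; rewrite xy => E.
  have {}E : exists j, x = y + 1 + 3 * j \/ x = y + 2 + 3 * j.
    exists ((x - y) %/ 3)%Z; have := divz_eq (x - y) 3; have := modz_ge0 (x - y) (isT :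
        3 != 0 :> int).
    have := ltz_pmod (x - y) (isT : 0 < 3 :> int).
    move: (_ %/ _)%Z (_ %% _)%Z => q r r3 r0 E2; rewrite E2 in E.
    have [r_|[r_|r_]] : r = 0 \/ r = 1 \/ r = 2 by lia.
    - have : 9 * q ^+ 2 = (3 * n).+1%:Z + 3 * k by rewrite -E r_; ring.
      by clear E; lia.
    - by left; rewrite -[x](subrK y) E2 r_; ring.
    - by right; rewrite -[x](subrK y) E2 r_; ring.
  have {E}[j [->|->]] := E.
    have -> : y + 1 + 3 * j + 2 * y = 1 + 3 * (y + j) by ring.
    have -> : y + 2 * (y + 1 + 3 * j) = 2 + 3 * (y + 2 * j) by ring.
    by rewrite !wD3 [w ^ 2]w2 expr1z addrC subrK.
  have -> : y + 2 + 3 * j + 2 * y = 2 + 3 * (y + j) by ring.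
  have -> : y + 2 * (y + 2 + 3 * j) = 1 + 3 * (y + 1 + 2 * j) by ring.
  by rewrite !wD3 [w ^ 2]w2 expr1z subrK.
rewrite big_const_seq count_predT iter_addr_0.
rewrite eis_sphere_size; last by lia.
rewrite mulNrn pmulrn -!rmorphD -rmorphN => /intr_inj; lia.
Qed.

Lemma aser_ge0 n : 0 <= aser n. Proof. by rewrite aser_count. Qed.

Lemma cser_ge0 n : 0 <= cser n. Proof. by have := cser_count n; lia. Qed.

Lemma aser3 n : aser (3 * n)%N = aser n.
Proof. by rewrite !aser_count eis_count3. Qed.

Lemma aser3D1 n : aser (3 * n).+1 = 2 * cser n.
Proof. by rewrite aser_count cser_count. Qed.

Lemma aser3D2 n : aser (3 * n).+2 = 0.
Proof.
rewrite aser_count /eis_count; case E : (eis_sphere _ _) => [|[x y] s] //.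
have : (x, y) \in eis_sphere (3 * n).+3 (3 * n).+2 by rewrite E mem_head.
rewrite mem_eis_sphere //= => /eqP xy; have := eis_norm_neq2 x y; rewrite xy; lia.
Qed.

(** * The cubic identity *)

Section Twist.
Variables (F : fieldType) (w : F).
Hypothesis pw : 3.-primitive_root w.
Local Notation X := (fpsX F).

Definition fps_twist (f : fps F) : fps F := Fps (fun n => w ^+ n * f n).

Lemma coef_fps_twist f n : fps_twist f n = w ^+ n * f n. Proof. by []. Qed.

Fact fps_twist_zmod_morphism : zmod_morphism fps_twist.
Proof. by move=> f g; apply/fpsP => n; rewrite /= mulrBr. Qed.

Fact fps_twist_monoid_morphism : monoid_morphism fps_twist.
Proof.
split=> [|f g]; apply/fpsP => n.
  by rewrite /=; case: n => [|n]; rewrite ?expr0 ?mul1r ?mulr0.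
rewrite /= mulr_sumr; apply: eq_bigr => i _.
by rewrite -{1}(subnKC (ltn_ord i : i <= n)%N) exprD; ring.
Qed.

HB.instance Definition _ := GRing.isZmodMorphism.Build (fps F) (fps F) fps_twist
    fps_twist_zmod_morphism.
HB.instance Definition _ := GRing.isMonoidMorphism.Build (fps F) (fps F) fps_twist
    fps_twist_monoid_morphism.

Lemma fps_twistM f g : fps_twist (f * g) = fps_twist f * fps_twist g.
Proof. exact: rmorphM. Qed.

Lemma eqmod_fps_twist N f g : fps_eqmod N f g -> fps_eqmod N (fps_twist f) (fps_twist
    g).
Proof. by move=> fg n nN /=; rewrite fg. Qed.

Lemma fps_twist_const c f : fps_twist (fps_const c * f) = fps_const c * fps_twist f.
Proof. by apply/fpsP => n; rewrite coef_fps_twist !coef_fps_constM mulrCA. Qed.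

Lemma fps_twistXn k : fps_twist (X ^+ k) = fps_const (w ^+ k) * X ^+ k.
Proof.
by apply/fpsP => n; rewrite coef_fps_constM coef_fps_twist coef_fpsXn; case: eqP =>
    [->|_]; rewrite ?mulr0.
Qed.

Lemma fps_twist_cube f : fps_twist (cube_subst f) = cube_subst f.
Proof.
apply/fpsP => n; rewrite /= cube_substE; case: ifP => [/dvdnP[k ->]|_];
    last by rewrite mulr0.
by rewrite mulnC exprM (prim_expr_order pw) expr1n mul1r.
Qed.

Lemma fps_const_root (u : F) : u ^+ 2 = - 1 - u -> fps_const u * fps_const u = - 1 -
    fps_const u.
Proof.
move=> u2; apply/fpsP => n; rewrite coef_fps_constM coef_fpsD !coef_fpsN coef_fps1.
by case: n => [|n] /=; rewrite -?expr2 ?u2 ?mulr1n ?mulr0n ?mulr0 ?oppr0 ?addr0 ?oppr0.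
Qed.

(** As the exponents [i + 3 j] are prime to 3, the three conjugates of each factor multiply to
    [1 - X ^ (3 (i + 3 j))]. *)
Lemma norm_qpoch3 i : coprime i 3 ->
  qpoch F 3 i * (fps_twist (qpoch F 3 i) * fps_twist (fps_twist (qpoch F 3 i))) =
      qpoch F 9 (3 * i).
Proof.
move=> ci; have i0 : (0 < i)%N by case: i ci.
apply: eq_from_eqmod => N; apply: (@eqmodW _ N.+1) => //.
have H := @eqmod_qpoch F 3 i N isT i0.
apply: eqmod_trans (eqmodM H (eqmodM (eqmod_fps_twist H) (eqmod_fps_twist
    (eqmod_fps_twist H)))) _.
apply: eqmod_trans _ (eqmod_sym (@eqmod_qpoch F 9 (3 * i) N isT _));
    last by rewrite muln_gt0.
rewrite !rmorph_prod -!big_split; apply: eqmod_prod => j _ n _; congr (fps_coef _ n).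
set k := (i + 3 * j)%N; pose W := fps_const (w ^+ k).
have W2 : W * W = - 1 - W.
  apply: fps_const_root; apply: cube_root1_sum.
  by rewrite (prim_root_exp_coprime k pw) /k coprime_sym /coprime addnC mulnC gcdnMDl
      gcdnC.
have := @cube_roots_prod _ W (X ^+ k) 1 W2.
rewrite !rmorphB !rmorph1 /= fps_twistXn fps_twist_const fps_twistXn.
rewrite (_ : 3 * i + 9 * j = k * 3)%N ?exprM /k; last by lia.
rewrite -/k -/W expr1n; move: (X ^+ k) => x E.
by rewrite -[RHS]opprB -E; ring.
Qed.

End Twist.

Section Norm.
Variables (F : fieldType) (w : F).
Hypothesis pw : 3.-primitive_root w.
Local Notation X := (fpsX F).
Local Notation E k := (qpoch F k k).

(** The product of [f(q)], [f(w q)] and [f(w ^ 2 q)], a multiplicative norm to series in [q ^ 3].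
    Applied to [euler_cube] it yields the cubic identity with [q ^ 3] for [q]. *)
Definition fps_norm3 (f : fps F) := f * (fps_twist w f * fps_twist w (fps_twist w f)).

Lemma fps_norm3M f g : fps_norm3 (f * g) = fps_norm3 f * fps_norm3 g.
Proof. by rewrite /fps_norm3 !fps_twistM; ring. Qed.

Lemma fps_norm3_cube f : fps_norm3 (cube_subst f) = cube_subst f ^+ 3.
Proof. by rewrite /fps_norm3 !fps_twist_cube //; ring. Qed.

Lemma fps_norm3_binomial f g :
  fps_norm3 (cube_subst f - X * cube_subst g) = cube_subst (f ^+ 3 - X * g ^+ 3).
Proof.
pose W := fps_const w.
have W2 : W * W = - 1 - W := fps_const_root (cube_root1_sum pw).
have twX : fps_twist w X = W * X by rewrite -[X]expr1 fps_twistXn expr1.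
have twXg : fps_twist w (X * cube_subst g) = W * (X * cube_subst g).
  by rewrite fps_twistM fps_twist_cube // twX mulrA.
have tw1 : fps_twist w (cube_subst f - X * cube_subst g) = cube_subst f - W * (X *
    cube_subst g).
  by rewrite rmorphB /= twXg fps_twist_cube.
have tw2 : fps_twist w (cube_subst f - W * (X * cube_subst g)) = cube_subst f - W * W *
    (X * cube_subst g).
  by rewrite rmorphB /= fps_twist_const twXg fps_twist_cube // mulrA.
rewrite /fps_norm3 tw1 tw2 cube_substB cube_substM !cube_subst_exp cube_substX -exprMn.
have := cube_roots_prod (X * cube_subst g) (cube_subst f) W2.
by move=> /(congr1 -%R); rewrite opprB => <-; ring.
Qed.

Lemma fps_norm3_euler : fps_norm3 (E 1) * E 9 = E 3 ^+ 4.
Proof.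
have E3 : E 3 = cube_subst (E 1) by rewrite cube_subst_qpoch // muln1.
have N3 : fps_norm3 (E 3) = E 3 ^+ 3 by rewrite E3 fps_norm3_cube.
have -> : E 1 = qpoch F 3 1 * qpoch F 3 2 *
    E 3 by rewrite (qpoch_trisect F (m := 1) (i := 1)).
rewrite !fps_norm3M N3 [fps_norm3 (qpoch _ 3 1)](norm_qpoch3 pw) // [fps_norm3
    _](norm_qpoch3 pw) //.
have -> : E 3 ^+ 4 = E 3 ^+ 3 * (qpoch F 9 3 * qpoch F 9 6 * E 9).
  by rewrite exprSr [in X in _ * X = _](qpoch_trisect F (m := 3) (i := 3)).
by rewrite muln1; ring.
Qed.

End Norm.

Lemma fps_map_cube_subst (R S : comUnitRingType) (phi : {rmorphism R -> S}) f :
  fps_map phi (cube_subst f) = cube_subst (fps_map phi f).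
Proof.
by apply/fpsP => n; rewrite /= !cube_substE; case: ifP; rewrite ?rmorph0.
Qed.

Lemma cube_subst_inj (R : comUnitRingType) : injective (@cube_subst R).
Proof.
move=> f g /fpsP fg; apply/fpsP => n; have := fg (3 * n)%N.
by rewrite !cube_substE dvdn_mulr // mulKn.
Qed.

(* The cubic identity [b ^ 3 = a ^ 3 - c ^ 3] of the Borweins, where
   [b = E 1 ^+ 3 / E 3]. *)
Lemma borwein_cubic : E 1 ^+ 9 = E 3 ^+ 3 * (aser ^+ 3 - X * cser ^+ 3).
Proof.
have [w pw] := @C_prim_root_exists 3 isT.
pose phi := fps_map (intr : int -> algC).
have phi_inj : injective phi.
  by move=> f g /fpsP fg; apply/fpsP => n; apply: intr_inj; apply: fg.
apply: cube_subst_inj; apply: phi_inj.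
have phiE k : (0 < k)%N -> phi (E k) = qpoch _ k k by move=> k0;
    rewrite /phi fps_map_qpoch.
have E3 : qpoch algC 3 3 = cube_subst (qpoch algC 1 1) by rewrite cube_subst_qpoch //
    muln1.
have E9 : qpoch algC 9 9 = cube_subst (qpoch algC 3 3) by rewrite cube_subst_qpoch.
have H := congr1 phi euler_cube.
rewrite /phi rmorphXn rmorphM /= -/phi !phiE // /phi rmorphB rmorphM /= in H.
rewrite !fps_map_cube_subst fps_mapX in H.
have H2 := congr1 (fps_norm3 w) H.
rewrite !exprS expr0 mulr1 !fps_norm3M fps_norm3_binomial // E3 fps_norm3_cube // -E3
    in H2.
have N1 := fps_norm3_euler pw.
have H3 : qpoch algC 3 3 ^+ 3 * (qpoch algC 3 3 ^+ 9) =
  qpoch algC 3 3 ^+ 3 * (qpoch algC 9 9 ^+ 3 *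
    cube_subst (fps_map (intr : int -> algC) aser ^+ 3 - fpsX algC * fps_map (intr :
        int -> algC) cser ^+ 3)).
  rewrite -exprD -[(3 + 9)%N]/(4 * 3)%N exprM -N1 exprMn [RHS]mulrCA [LHS]mulrC;
      congr (_ * _).
  by apply: etrans H2; ring.
have {}H3 := mulrI (unitrX 3 (qpoch_unit algC (isT : 0 < 3)%N (isT : 0 < 3)%N)) H3.
have phiX f k : phi (f ^+ k) = phi f ^+ k by exact: rmorphXn.
have phiM f g : phi (f * g) = phi f * phi g by exact: rmorphM.
have phiB f g : phi (f - g) = phi f - phi g by exact: rmorphB.
rewrite [LHS]fps_map_cube_subst [RHS]fps_map_cube_subst -/phi !(phiX, phiM,
    phiB) !phiE //.
rewrite [phi X]fps_mapX cube_substM !(cube_subst_exp (qpoch _ _ _)) -E3 -E9.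
exact: H3.
Qed.

(** * Trisections of the eta quotient *)

Definition qinv (i : nat) : fps int := locked (qpoch int 9 i)^-1.

Lemma qinvK i : (0 < i)%N -> qpoch int 9 i * qinv i = 1.
Proof. by move=> i0; rewrite /qinv -lock mulrV // qpoch_unit. Qed.

(* The series [A], [B], [D] of the introduction. *)
Definition qA := qinv 1 * qinv 8 * (qinv 2 * qinv 7) * (qinv 3 * qinv 6).
Definition qB := qinv 1 * qinv 8 * (qinv 4 * qinv 5) * (qinv 3 * qinv 6).
Definition qD := qinv 2 * qinv 7 * (qinv 4 * qinv 5) * (qinv 3 * qinv 6).

Lemma euler9 : E 1 = qpoch int 9 1 * qpoch int 9 2 * qpoch int 9 3 * qpoch int 9 4 *
  qpoch int 9 5 * qpoch int 9 6 * qpoch int 9 7 * qpoch int 9 8 * E 9.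
Proof.
rewrite (qpoch_trisect int (m := 1) (i := 1)) // !muln1.
rewrite (@qpoch_trisect int 3 1) // (@qpoch_trisect int 3 2) // (@qpoch_trisect int 3
    3) //.
by rewrite /=; ring.
Qed.

(** The factors of [E 1] run over all residues modulo 9, so each part of [euler_trisection] is [E 1]
    times an inverse product. This form has nonnegative series in place of products of mixed
    signs. *)
Lemma euler_trisection_inv :
  E 1 = E 3 * (cube_subst qA - X * cube_subst qB - X ^+ 2 * cube_subst qD).
Proof.
have q1 := @qinvK 1 isT; have q2 := @qinvK 2 isT; have q3 := @qinvK 3 isT;
    have q4 := @qinvK 4 isT.
have q5 := @qinvK 5 isT; have q6 := @qinvK 6 isT; have q7 := @qinvK 7 isT;
    have q8 := @qinvK 8 isT.
have hA : E 1 * qA = E 9 * (qpoch int 9 4 * qpoch int 9 5).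
  rewrite euler9 /qA.
  transitivity (E 9 * (qpoch int 9 4 * qpoch int 9 5) * (qpoch int 9 1 * qinv 1) *
      (qpoch int 9 2 * qinv 2)
    * (qpoch int 9 3 * qinv 3) * (qpoch int 9 6 * qinv 6) * (qpoch int 9 7 * qinv 7) *
        (qpoch int 9 8 * qinv 8)); first by ring.
  by rewrite q1 q2 q3 q6 q7 q8 !mulr1.
have hB : E 1 * qB = E 9 * (qpoch int 9 7 * qpoch int 9 2).
  rewrite euler9 /qB.
  transitivity (E 9 * (qpoch int 9 7 * qpoch int 9 2) * (qpoch int 9 1 * qinv 1) *
      (qpoch int 9 4 * qinv 4)
    * (qpoch int 9 3 * qinv 3) * (qpoch int 9 6 * qinv 6) * (qpoch int 9 5 * qinv 5) *
        (qpoch int 9 8 * qinv 8)); first by ring.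
  by rewrite q1 q4 q3 q6 q5 q8 !mulr1.
have hD : E 1 * qD = E 9 * (qpoch int 9 1 * qpoch int 9 8).
  rewrite euler9 /qD.
  transitivity (E 9 * (qpoch int 9 1 * qpoch int 9 8) * (qpoch int 9 2 * qinv 2) *
      (qpoch int 9 4 * qinv 4)
    * (qpoch int 9 3 * qinv 3) * (qpoch int 9 6 * qinv 6) * (qpoch int 9 5 * qinv 5) *
        (qpoch int 9 7 * qinv 7)); first by ring.
  by rewrite q2 q4 q3 q6 q5 q7 !mulr1.
rewrite {1}euler_trisection -hA -hB -hD !cube_substM cube_subst_E1; ring.
Qed.

Definition e1inv : fps int := locked (E 1)^-1.

Lemma e1invK : E 1 * e1inv = 1.
Proof. by rewrite /e1inv -lock mulrV // E_unit. Qed.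

Lemma e3invK : E 3 * cube_subst e1inv = 1.
Proof. by rewrite -cube_subst_E1 -cube_substM e1invK rmorph1. Qed.

Definition qZ0 := aser ^+ 2 * qA + X * (2%:R * aser * cser * qD - cser ^+ 2 * qB).
Definition qZ1 := aser ^+ 2 * qB + 2%:R * aser * cser * qA + X * cser ^+ 2 * qD.
Definition qZ2 := 2%:R * aser * cser * qB + cser ^+ 2 * qA - aser ^+ 2 * qD.

(** Since [E_1^7 / E_3^3 = (E_1^3 / E_3)^2 (E_1 / E_3)], it suffices to expand the square of
    [a - q c] times [A - q B - q^2 D], all four variables taken at [q ^ 3]. *)
Lemma trisection_Z : (aser ^+ 3 - X * cser ^+ 3) * e1inv ^+ 2 =
  cube_subst qZ0 + X * cube_subst (- qZ1) + X ^+ 2 * cube_subst qZ2.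
Proof.
have cs2 : cube_subst (2%:R : fps int) = 2%:R by rewrite rmorph_nat.
have -> : cube_subst qZ0 + X * cube_subst (- qZ1) + X ^+ 2 * cube_subst qZ2 =
  (cube_subst aser - X * cube_subst cser) ^+ 2 * (cube_subst qA - X * cube_subst qB -
      X ^+ 2 * cube_subst qD).
  rewrite /qZ0 /qZ1 /qZ2 !(cube_substN, cube_substD, cube_substB, cube_substM,
      cube_subst_exp, cs2, cube_substX).
  ring.
have u3 : E 3 ^+ 3 * E 1 ^+ 2 \is a GRing.unit by rewrite unitrM !unitrX ?E_unit.
apply: (mulrI u3).
transitivity (E 1 ^+ 9).
  transitivity ((E 3 ^+ 3 * (aser ^+ 3 - X * cser ^+ 3)) * (E 1 * e1inv) ^+ 2);
      first by ring.
  by rewrite -borwein_cubic e1invK expr1n mulr1.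
transitivity ((E 3 * (cube_subst aser - X * cube_subst cser)) ^+ 2 *
   (E 3 * (cube_subst qA - X * cube_subst qB - X ^+ 2 * cube_subst qD)) * E 1 ^+ 2);
       last by ring.
by rewrite -euler_cube -euler_trisection_inv; ring.
Qed.

Lemma eta_quotientE : eta_quotient_1_9_3_m5 * E 3 ^+ 5 = E 1 ^+ 9.
Proof.
have X0 : (X ^+ 3) 0%N = 0 by rewrite coef_fpsXn.
rewrite /eta_quotient_1_9_3_m5 !qpochE expr1 divrK // unitrX // qPochhammer_unit //.
Qed.

Lemma eta_trisection : eta_quotient_1_9_3_m5 =
  cube_subst ((aser ^+ 3 - X * cser ^+ 3) * e1inv ^+ 2)
  + X * cube_subst (- (3%:R * aser ^+ 2 * cser * e1inv ^+ 2))
  + X ^+ 2 * cube_subst (3%:R * aser * cser ^+ 2 * e1inv ^+ 2).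
Proof.
have cs3 : cube_subst (3%:R : fps int) = 3%:R by rewrite rmorph_nat.
have -> : cube_subst ((aser ^+ 3 - X * cser ^+ 3) * e1inv ^+ 2)
  + X * cube_subst (- (3%:R * aser ^+ 2 * cser * e1inv ^+ 2))
  + X ^+ 2 * cube_subst (3%:R * aser * cser ^+ 2 * e1inv ^+ 2) =
  (cube_subst aser - X * cube_subst cser) ^+ 3 * cube_subst e1inv ^+ 2.
  rewrite !(cube_substN, cube_substD, cube_substB, cube_substM, cube_subst_exp, cs3,
      cube_substX).
  ring.
have u3 : E 3 ^+ 5 \is a GRing.unit by rewrite unitrX ?E_unit.
apply: (mulIr u3); rewrite eta_quotientE.
transitivity ((E 3 * (cube_subst aser - X * cube_subst cser)) ^+ 3 * (E 3 *
    cube_subst e1inv) ^+ 2); last by ring.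
by rewrite -euler_cube e3invK expr1n mulr1 -exprM.
Qed.

(** * Comparison of the products modulo 9 *)

Local Notation geom := (fps_geom int).

Definition fps_ge0 (f : fps int) := forall n, 0 <= f n.

Lemma fps_ge0D f g : fps_ge0 f -> fps_ge0 g -> fps_ge0 (f + g).
Proof. by move=> f0 g0 n; rewrite coef_fpsD addr_ge0. Qed.

Lemma fps_ge0M f g : fps_ge0 f -> fps_ge0 g -> fps_ge0 (f * g).
Proof. by move=> f0 g0 n; rewrite coef_fpsM sumr_ge0 // => i _; rewrite mulr_ge0. Qed.

Lemma fps_ge0_1 : fps_ge0 1.
Proof. by move=> n; rewrite coef_fps1. Qed.

Lemma fps_ge0_exp f k : fps_ge0 f -> fps_ge0 (f ^+ k).
Proof.
by move=> f0; elim: k => [|k IH]; rewrite ?expr0 ?exprS; [apply: fps_ge0_1 | apply: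
    fps_ge0M].
Qed.

Lemma fps_ge0_nat k : fps_ge0 k%:R.
Proof.
elim: k => [|k IH]; first by move=> n.
by rewrite mulrSr; apply: fps_ge0D => //; apply: fps_ge0_1.
Qed.

Lemma fps_ge0_Xn k : fps_ge0 (X ^+ k).
Proof. by move=> n; rewrite coef_fpsXn. Qed.

Lemma fps_ge0_X : fps_ge0 X. Proof. exact: (@fps_ge0_Xn 1). Qed.

Lemma fps_ge0_geom k : (0 < k)%N -> fps_ge0 (geom k).
Proof. by move=> k0 n; rewrite coef_fps_geom. Qed.

Lemma fps_ge0_prod (I : Type) (r : seq I) (F : I -> fps int) :
  (forall i, fps_ge0 (F i)) -> fps_ge0 (\prod_(i <- r) F i).
Proof. by move=> F0; apply: big_ind => [|f g|i _]; [apply: fps_ge0_1 | apply: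
    fps_ge0M | apply: F0]. Qed.

Lemma fps_ge0_lim f (u : nat -> fps int) :
  (forall N, fps_eqmod N f (u N)) -> (forall N, fps_ge0 (u N)) -> fps_ge0 f.
Proof. by move=> fu u0 n; rewrite (fu n.+1) ?u0. Qed.

Lemma eqmod_qinv i N : (0 < i)%N -> fps_eqmod N (qinv i) (\prod_(j < N) geom (i + 9 *
    j)).
Proof.
move=> i0; apply: (eqmod_unit_cancel (qpoch_unit int (isT : 0 < 9)%N i0));
    rewrite qinvK //.
apply: (@eqmod_trans _ _ (\prod_(j < N) (1 - X ^+ (i + 9 * j)) *
    \prod_(j < N) geom (i + 9 * j))).
  by rewrite -big_split big1 //= => j _; rewrite fps_geomK // addn_gt0 i0.
by apply: eqmodM => //; apply: eqmod_sym; apply: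
    (eqmodW _ (@eqmod_qpoch int 9 i N isT i0)).
Qed.

Lemma qinv_ge0 i : (0 < i)%N -> fps_ge0 (qinv i).
Proof.
move=> i0; apply: (fps_ge0_lim (fun N => @eqmod_qinv i N i0)) => N.
by apply: fps_ge0_prod => j; apply: fps_ge0_geom; rewrite addn_gt0 i0.
Qed.

Lemma qinv_recl i : (0 < i)%N -> qinv i = geom i * qinv (i + 9).
Proof.
move=> i0; have i90 : (0 < i + 9)%N by rewrite addn_gt0 i0.
apply: (mulrI (qpoch_unit int (isT : 0 < 9)%N i0)); rewrite qinvK // qpoch_recl //.
transitivity (((1 - X ^+ i) * geom i) * (qpoch int 9 (i + 9) * qinv (i + 9)));
    last by ring.
by rewrite fps_geomK // qinvK // mulr1.
Qed.

(** Telescoping, by [B b - C c = B (b - c) + c (B - C)]. Each step uses [D] once, so a single [D]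
    with nonnegative [D (b j - c j)] for all [j] is enough. *)
Lemma fps_ge0_prod_sub (D : fps int) (b c : nat -> fps int) N :
  (forall j, fps_ge0 (b j)) -> (forall j, fps_ge0 (c j)) ->
  (forall j, fps_ge0 (D * (b j - c j))) ->
  fps_ge0 (D * (\prod_(j < N) b j - \prod_(j < N) c j)).
Proof.
move=> b0 c0 bc; elim: N => [|N IH]; first by rewrite !big_ord0 subrr mulr0.
rewrite !big_ord_recr /=.
set B := \prod_(j < N) b j; set C := \prod_(j < N) c j.
have -> : D * (B * b N - C * c N) = B * (D * (b N - c N)) + c N * (D * (B - C)) by ring.
by apply: fps_ge0D; apply: fps_ge0M => //; apply: fps_ge0_prod.
Qed.

Lemma geom_sub p q r s : (0 < p)%N -> (0 < q)%N -> (0 < r)%N -> (0 < s)%N ->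
  geom p * geom q - geom r * geom s =
  ((1 - X ^+ r) * (1 - X ^+ s) - (1 - X ^+ p) * (1 - X ^+ q)) * (geom p * geom q *
      (geom r * geom s)).
Proof.
move=> p0 q0 r0 s0.
transitivity (((1 - X ^+ r) * geom r) * ((1 - X ^+ s) * geom s) * (geom p * geom q)
  - ((1 - X ^+ p) * geom p) * ((1 - X ^+ q) * geom q) * (geom r * geom s));
      last by ring.
by rewrite !fps_geomK // !mul1r.
Qed.

(** In the applications [p + q = r + s], and the bracket is [X ^ (p + 9 j) (1 - X ^ (r - p)) (1 - X
    ^ (s - p))]. The last two factors do not depend on [j], so one [D] cancels them for all [j]. *)
Lemma qinv_prod_sub_ge0 (D : fps int) p q r s :
  (0 < p)%N -> (0 < q)%N -> (0 < r)%N -> (0 < s)%N ->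
  (forall j, fps_ge0 (D * ((1 - X ^+ (r + 9 * j)) * (1 - X ^+ (s + 9 * j))
                   - (1 - X ^+ (p + 9 * j)) * (1 - X ^+ (q + 9 * j))))) ->
  fps_ge0 (D * (qinv p * qinv q - qinv r * qinv s)).
Proof.
move=> p0 q0 r0 s0 H.
pose b j := geom (p + 9 * j) * geom (q + 9 * j); pose c j := geom (r + 9 * j) *
    geom (s + 9 * j).
apply: (@fps_ge0_lim _ (fun N => D * (\prod_(j < N) b j - \prod_(j < N) c j))) => N.
  apply: eqmodM => //; rewrite /b /c !big_split.
  by apply: eqmodB; apply: eqmodM; apply: eqmod_qinv.
have g0 k j : (0 < k)%N -> fps_ge0 (geom (k + 9 * j)).
  by move=> k0; apply: fps_ge0_geom; rewrite addn_gt0 k0.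
have gg k l j : (0 < k)%N -> (0 < l)%N -> fps_ge0 (geom (k + 9 * j) * geom (l + 9 * j)).
  by move=> k0 l0; apply: fps_ge0M; apply: g0.
apply: fps_ge0_prod_sub => j; rewrite /b /c; [exact: gg | exact: gg |].
rewrite geom_sub ?addn_gt0 ?p0 ?q0 ?r0 ?s0 //.
by rewrite [D * _]mulrA; apply: fps_ge0M; [exact: (H j) | apply: fps_ge0M; apply: gg].
Qed.

Ltac prod_ge0 := repeat first
  [ apply: fps_ge0D | apply: fps_ge0M | apply: fps_ge0_exp | exact: fps_ge0_X | exact:
      fps_ge0_1 | exact: fps_ge0_Xn
  | (apply: qinv_ge0; done) | (apply: fps_ge0_geom; done) | exact: fps_ge0_nat | done ].

Lemma qB_ge_qD : fps_ge0 (qB - qD).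
Proof.
have g k : (0 < k)%N -> (1 - X ^+ k) * geom k = 1 by exact: fps_geomK.
pose H := qinv 4 * qinv 5 * qinv 3 * qinv 15.
have -> : qB - qD = H * ((geom 1 * geom 8 * geom 6) * (qinv 10 * qinv 17 - qinv 11 *
    qinv 16))
   + H * geom 6 * (qinv 11 * qinv 16) * (geom 1 * geom 8 - geom 2 * geom 7).
  rewrite /qB /qD /H (@qinv_recl 1) // (@qinv_recl 8) // (@qinv_recl 2) // (@qinv_recl
      7) //.
  rewrite (@qinv_recl 6) //.
  move: (qinv 10) (qinv 17) (qinv 11) (qinv 16) (qinv 4) (qinv 5) (qinv 3) (qinv 15)
      (geom 1) (geom 8) (geom 2) (geom 7) (geom 6) =>
      q10 q17 q11 q16 q4 q5 q3 q15 g1 g8 g2 g7 g6; ring.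
apply: fps_ge0D; last first.
  rewrite geom_sub //.
  have -> : ((1 - X ^+ 2) * (1 - X ^+ 7) - (1 - X ^+ 1) * (1 - X ^+ 8)) * (geom 1 *
      geom 8 * (geom 2 * geom 7))
   = X * ((1 - X ^+ 1) * geom 1) * ((1 - X ^+ 2) * geom 2) * (1 + X ^+ 2 + X ^+ 4) *
       (geom 7 * geom 8).
    by move: (geom 1) (geom 8) (geom 2) (geom 7) => g1 g8 g2 g7; ring.
  by rewrite !g // /H !mulr1; prod_ge0.
apply: fps_ge0M; first by rewrite /H; prod_ge0.
apply: qinv_prod_sub_ge0 => // j.
rewrite !(exprD _ _ (9 * j)); move: (X ^+ (9 * j)) (@fps_ge0_Xn (9 * j)) => Y Y0.
have -> : geom 1 * geom 8 * geom 6 * ((1 - X ^+ 11 * Y) * (1 - X ^+ 16 * Y) - (1 -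
    X ^+ 10 * Y) * (1 - X ^+ 17 * Y))
  = geom 8 * ((1 - X ^+ 1) * geom 1) * ((1 - X ^+ 6) * geom 6) * (X ^+ 10 * Y).
  by move: (geom 1) (geom 8) (geom 6) => g1 g8 g6; ring.
by rewrite !g // !mulr1; prod_ge0.
Qed.

Lemma qD_ge_qB : fps_ge0 ((1 + X) * qD - qB).
Proof.
have g k : (0 < k)%N -> (1 - X ^+ k) * geom k = 1 by exact: fps_geomK.
pose H := qinv 4 * qinv 5 * qinv 12 * qinv 6.
(* The factor [1 + X] turns the first factor of [qD] into that of [qB], and the remaining factors
   differ only in the pairs 7, 11 and 8, 10. *)
have g2 : (1 + X) * geom 2 = geom 1.
  apply: (mulrI (fps_unit1BXn int (isT : 0 < 1)%N)); rewrite g //.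
  by transitivity ((1 - X ^+ 2) * geom 2); [ring | rewrite g].
have -> : (1 + X) * qD - qB = H * ((geom 1 * geom 3) * (qinv 7 * qinv 11 - qinv 8 *
    qinv 10)).
  rewrite /qB /qD /H (@qinv_recl 1) // (@qinv_recl 2) // (@qinv_recl 3) //.
  by transitivity (((1 + X) * geom 2) * (qinv 11 * qinv 7) * (qinv 4 * qinv 5) *
      (geom 3 * qinv 12 * qinv 6)
     - geom 1 * qinv 10 * qinv 8 * (qinv 4 * qinv 5) * (geom 3 * qinv 12 * qinv 6));
         [| rewrite g2];
    move: (qinv 11) (qinv 7) (qinv 4) (qinv 5) (qinv 12) (qinv 6) (qinv 10) (qinv 8)
        (geom 2) (geom 3) (geom 1) => *; ring.
apply: fps_ge0M; first by rewrite /H; prod_ge0.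
apply: qinv_prod_sub_ge0 => // j.
rewrite !(exprD _ _ (9 * j)); move: (X ^+ (9 * j)) (@fps_ge0_Xn (9 * j)) => Y Y0.
have -> : geom 1 * geom 3 * ((1 - X ^+ 8 * Y) * (1 - X ^+ 10 * Y) - (1 - X ^+ 7 * Y) *
    (1 - X ^+ 11 * Y))
  = ((1 - X ^+ 1) * geom 1) * ((1 - X ^+ 3) * geom 3) * (X ^+ 7 * Y).
  by move: (geom 1) (geom 3) => g1 g3; ring.
by rewrite !g // !mulr1; prod_ge0.
Qed.

Lemma qA_ge_qD : fps_ge0 (qA - (1 + X) * qD).
Proof.
have g k : (0 < k)%N -> (1 - X ^+ k) * geom k = 1 by exact: fps_geomK.
pose H := qinv 11 * qinv 12 * qinv 6 * qinv 7.
(* The factors of index 0 are split off: they provide the multiplier for the tails, and they alone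
   have to make up for [1 + X]. *)
have -> : qA - (1 + X) * qD =
   H * ((geom 1 * geom 8 * geom 2 * geom 3) * (qinv 10 * qinv 17 - qinv 13 * qinv 14))
   + H * (qinv 13 * qinv 14) * (geom 2 * geom 3 * (geom 1 * geom 8 - (1 + X) *
       (geom 4 * geom 5))).
  rewrite /qA /qD /H (@qinv_recl 1) // (@qinv_recl 8) // (@qinv_recl 2) // (@qinv_recl
      3) //.
  rewrite (@qinv_recl 4) // (@qinv_recl 5) //.
  move: (qinv 10) (qinv 17) (qinv 13) (qinv 14) (qinv 11) (qinv 12) (qinv 6) (qinv 7)
      (geom 1) (geom 8) (geom 2) (geom 3) (geom 4) (geom 5) =>
      q10 q17 q13 q14 q11 q12 q6 q7 g1 g8 g2 g3 g4 g5; ring.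
apply: fps_ge0D; last first.
  have -> : geom 2 * geom 3 * (geom 1 * geom 8 - (1 + X) * (geom 4 * geom 5)) =
    X ^+ 2 * geom 1 * geom 5 * geom 8 + X ^+ 6 * geom 5 * geom 8 * geom 2 * geom 3.
    transitivity (geom 2 * geom 3 * (((1 - X ^+ 4) * geom 4) * ((1 - X ^+ 5) *
        geom 5) * geom 1 * geom 8
      - (1 + X) * ((1 - X ^+ 1) * geom 1) * ((1 - X ^+ 8) * geom 8) * (geom 4 *
          geom 5))).
      by rewrite !g //; ring.
    transitivity (((1 - X ^+ 4) * geom 4) * (X ^+ 2 * geom 1 * geom 5 * geom 8 * ((1 -
        X ^+ 2) * geom 2) * ((1 - X ^+ 3) * geom 3)
       + X ^+ 6 * geom 5 * geom 8 * geom 2 * geom 3 * ((1 - X ^+ 1) * geom 1))).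
      by move: (geom 1) (geom 2) (geom 3) (geom 4) (geom 5) (geom 8) =>
          g1 g2 g3 g4 g5 g8; ring.
    by rewrite !g //; ring.
  by rewrite /H; prod_ge0.
apply: fps_ge0M; first by rewrite /H; prod_ge0.
apply: qinv_prod_sub_ge0 => // j.
rewrite !(exprD _ _ (9 * j)); move: (X ^+ (9 * j)) (@fps_ge0_Xn (9 * j)) => Y Y0.
have -> : geom 1 * geom 8 * geom 2 * geom 3 * ((1 - X ^+ 13 * Y) * (1 - X ^+ 14 * Y) -
    (1 - X ^+ 10 * Y) * (1 - X ^+ 17 * Y))
  = geom 8 * geom 2 * ((1 - X ^+ 3) * geom 3) * ((1 - X ^+ 1) * geom 1) * (1 + X +
      X ^+ 2 + X ^+ 3) * (X ^+ 10 * Y).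
  by move: (geom 1) (geom 8) (geom 2) (geom 3) => g1 g8 g2 g3; ring.
by rewrite !g // !mulr1; prod_ge0.
Qed.

(** * Partial sums *)

(** Exchanging the sums over multiples and divisors turns a partial sum of [kronecker3_sum] into
    this one. The truncated subtraction is exact by [div_diff_le]. *)
Fixpoint div_diff_sum (n j : nat) : nat :=
  if j is j'.+1 then div_diff_sum n j' + (n %/ (3 * j' + 1) - n %/ (3 * j' + 2)) else 0.

Lemma div_diff_le n j : (n %/ (3 * j + 2) <= n %/ (3 * j + 1))%N.
Proof. by apply: leq_div2l; lia. Qed.

Lemma div_diff_sum_stable n j : (n %/ 3 < j)%N -> div_diff_sum n j =
    div_diff_sum n (n %/ 3).+1.
Proof.
elim: j => // j IH; rewrite ltnS leq_eqVlt => /predU1P[->//|nj].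
by rewrite [LHS]/= IH // (@divn_small n (3 * j + 1)) ?(@divn_small n (3 * j +
    2)) ?subnn ?addn0 //; lia.
Qed.

Lemma div_diff_sum_ge n i j : (i <= j)%N -> (div_diff_sum n i <= div_diff_sum n j)%N.
Proof.
elim: j => [|j IH]; first by rewrite leqn0 => /eqP ->.
by rewrite leq_eqVlt ltnS => /predU1P[->//|ij] /=; apply:
    leq_trans (IH ij) (leq_addr _ _).
Qed.

(** The bound of an alternating series: the tail is at most the first omitted term. *)
Lemma div_diff_sum_le n i j : (i <= j)%N ->
  (div_diff_sum n j + n %/ (3 * j + 1) <= div_diff_sum n i + n %/ (3 * i + 1))%N.
Proof.
elim: j => [|j IH]; first by rewrite leqn0 => /eqP ->.
rewrite leq_eqVlt ltnS => /predU1P[->//|ij] /=; apply: leq_trans _ (IH ij).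
have : (n %/ (3 * j.+1 + 1) <= n %/ (3 * j + 2))%N by apply: leq_div2l; lia.
move: (div_diff_le n j); move: (n %/ _)%N (n %/ _)%N (n %/ _)%N => a b c; lia.
Qed.

(** The partial sums of [a] (see [asumE]), as natural numbers that can be computed. *)
Definition asum (n : nat) : nat := 1 + 6 * div_diff_sum n (n %/ 3).+1.

Lemma sum_dvdn d n : (0 < d)%N -> (\sum_(k < n.+1) (d %| k) = (n %/ d).+1)%N.
Proof.
move=> d0; elim: n => [|n IH]; first by rewrite big_ord1 dvdn0 div0n.
by rewrite big_ord_recr /= IH divnS // addSn addnC.
Qed.

Lemma coef_geom1M f n : (geom 1 * f) n = \sum_(i < n.+1) f i.
Proof.
rewrite mulrC coef_fpsM; apply: eq_bigr => i _.
by rewrite coef_fps_geom // dvd1n mulr1.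
Qed.

Lemma div_diff_sumE n j :
  (div_diff_sum n j)%:Z = \sum_(i < j) ((n %/ (3 * i + 1))%N%:Z - (n %/ (3 * i +
      2))%N%:Z).
Proof.
elim: j => [|j IH]; first by rewrite big_ord0.
by rewrite big_ord_recr -IH /= PoszD -subzn ?div_diff_le.
Qed.

Lemma asumE n : (geom 1 * aser) n = (asum n)%:Z.
Proof.
rewrite coef_geom1M /asum -(@div_diff_sum_stable n n.+1); last by lia.
have -> : \sum_(i < n.+1) aser i = 1 + 6 * \sum_(i < n.+1) kronecker3_sum i.
  have E0 : \sum_(i < n.+1) (i == 0%N :> nat)%:R = 1 :> int.
    by rewrite big_ord_recl big1 ?addr0.
  by rewrite mulr_sumr -[X in X + _]E0 -big_split; apply: eq_bigr => i _;
      rewrite coef_aser.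
rewrite PoszD PoszM div_diff_sumE; congr (_ + _ * _).
rewrite (eq_bigr (fun i : 'I_n.+1 => _) (fun i _ =>
    kronecker3_sum_widen (ltnW (ltn_ord i)))).
rewrite exchange_big; apply: eq_bigr => j _; rewrite sumrB.
have H d : (0 < d)%N -> \sum_(k < n.+1) (d %| k)%N%:Z = (n %/ d).+1%:Z.
  by move=> d0; rewrite -(sum_dvdn n d0) (big_morph Posz PoszD (erefl _)).
by rewrite !H ?addn1 ?addn2 //; lia.
Qed.

(** The coefficients of [a] up to [3 n + 2] fall into those at [3 k], which repeat [a], those at
    [3 k + 1], which are [2 c], and zeros. *)
Lemma csumE n : 2 * (geom 1 * cser) n = (asum (3 * n + 2))%:Z - (asum n)%:Z.
Proof.
rewrite -!asumE !coef_geom1M addn2; elim: n => [|n IH].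
  rewrite !big_ord_recl !big_ord0 -[lift _ _ : nat]/1%N -[lift _ (lift _ _) : nat]/2%N.
  have := aser3D1 0; have := aser3D2 0; rewrite muln0 => -> ->; ring.
rewrite mulnS !addSn add0n [in LHS]big_ord_recr [in X in _ - X]big_ord_recr.
do 3!rewrite [in X in X - _]big_ord_recr /=.
rewrite mulrDr IH.
have := aser3 n.+1; have := aser3D1 n.+1; have := aser3D2 n.+1;
    rewrite mulnS !addSn add0n => -> -> ->.
by ring.
Qed.

(** Six pairs of the alternating sum, [d <= 17], give the rate [6 (1 - 1/2 + ... + 1/16 - 1/17) =
    3.516...]; rounding the quotients [n / d] costs less than 25.3. *)
Lemma asum_ge n : 351 * n%:Z - 2530 <= 100 * (asum n)%:Z.
Proof.
have : (asum n >= 1 + 6 * div_diff_sum n 6)%N.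
  rewrite /asum -(@div_diff_sum_stable n (n %/ 3 + 6)); last by lia.
  by rewrite leq_add2l leq_mul2l div_diff_sum_ge ?orbT //; lia.
move: (asum n) => s; rewrite /=.
have le i := div_diff_le n i; move: (le 0%N) (le 1%N) (le 2%N) (le 3%N) (le 4%N) (le
    5%N).
rewrite /=; have dv d (d0 : (0 < d)%N) : (n %/ d * d <= n < n %/ d * d + d)%N.
  by rewrite leq_trunc_div -mulSnr ltn_ceil.
move: (dv 1 isT); move: (n %/ 1)%N => q1.
move: (dv 2 isT); move: (n %/ 2)%N => q2.
move: (dv 4 isT); move: (n %/ 4)%N => q4.
move: (dv 5 isT); move: (n %/ 5)%N => q5.
move: (dv 7 isT); move: (n %/ 7)%N => q7.
move: (dv 8 isT); move: (n %/ 8)%N => q8.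
move: (dv 10 isT); move: (n %/ 10)%N => q10.
move: (dv 11 isT); move: (n %/ 11)%N => q11.
move: (dv 13 isT); move: (n %/ 13)%N => q13.
move: (dv 14 isT); move: (n %/ 14)%N => q14.
move: (dv 16 isT); move: (n %/ 16)%N => q16.
move: (dv 17 isT); move: (n %/ 17)%N => q17.
clear; lia.
Qed.

(** The same six pairs and the first omitted term [6 / 19] give the rate 3.832... *)
Lemma asum_le n : 100 * (asum n)%:Z <= 384 * n%:Z + 3100.
Proof.
have : (asum n <= 1 + 6 * (div_diff_sum n 6 + n %/ 19))%N.
  rewrite /asum -(@div_diff_sum_stable n (n %/ 3 + 6)); last by lia.
  rewrite leq_add2l leq_mul2l /=; apply: leq_trans (@div_diff_sum_le n 6 (n %/ 3 +
      6) _); last by lia.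
  exact: leq_addr.
move: (asum n) => s; rewrite /=.
have le i := div_diff_le n i; move: (le 0%N) (le 1%N) (le 2%N) (le 3%N) (le 4%N) (le
    5%N).
rewrite /=; have dv d (d0 : (0 < d)%N) : (n %/ d * d <= n < n %/ d * d + d)%N.
  by rewrite leq_trunc_div -mulSnr ltn_ceil.
move: (dv 1 isT); move: (n %/ 1)%N => q1.
move: (dv 2 isT); move: (n %/ 2)%N => q2.
move: (dv 4 isT); move: (n %/ 4)%N => q4.
move: (dv 5 isT); move: (n %/ 5)%N => q5.
move: (dv 7 isT); move: (n %/ 7)%N => q7.
move: (dv 8 isT); move: (n %/ 8)%N => q8.
move: (dv 10 isT); move: (n %/ 10)%N => q10.
move: (dv 11 isT); move: (n %/ 11)%N => q11.
move: (dv 13 isT); move: (n %/ 13)%N => q13.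
move: (dv 14 isT); move: (n %/ 14)%N => q14.
move: (dv 16 isT); move: (n %/ 16)%N => q16.
move: (dv 17 isT); move: (n %/ 17)%N => q17.
move: (dv 19 isT); move: (n %/ 19)%N => q19.
clear; lia.
Qed.

(* All arguments of [asum] in [asum_check asum n], [n < 140], are below 423. *)
Definition asum_tab : seq nat := map asum (iota 0 423).

(** In this order: nonnegativity of the coefficient of [qalpha], of [qbeta] and of
    [(2 c - a) / (1 - q)], and the inequality behind [qalpha_dominates], whose argument [n - 3] must
    be at least 3. The parameter [t] allows evaluation on the table. *)
Definition asum_check (t : nat -> nat) (n : nat) : bool :=
  [&& t (3 * n - 1) <= 2 * t n + 2 * t (n - 3) + t (n - 1),
      t (3 * n + 2) + t (3 * n - 7) + 4 * t (n - 1)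
        <= 7 * t n + t (n - 3) + 4 * t (n - 2),
      2 * t n <= t (3 * n + 2) &
      (n < 6) ||
      (t (3 * n - 1) + 6 * t (3 * n - 4) + 6 * t (3 * n - 10) + 3 * t (3 * n - 7)
        < (2 * t n + 2 * t (n - 3) + t (n - 1))
          + 6 * (2 * t (n - 1) + 2 * t (n - 4) + t (n - 2))
          + 6 * (2 * t (n - 3) + 2 * t (n - 6) + t (n - 4)) + 3 * t (n - 3))]%N.

Lemma asum_check_small n : (3 <= n)%N -> (n < 140)%N -> asum_check asum n.
Proof.
move=> n3 n140.
have /allP /(_ n) : all (asum_check (nth 0%N asum_tab)) (iota 3 137) by vm_compute.
rewrite mem_iota n3 => /(_ n140).
have tE k : (k < 423)%N -> nth 0%N asum_tab k = asum k.
  by move=> k423; rewrite /asum_tab (nth_map 0%N) ?size_iota // nth_iota.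
by rewrite /asum_check !tE //; lia.
Qed.

(** The second inequality decides the threshold: it compares ten upper with twelve lower rates, and
    [12 * 351 - 10 * 384 = 372] overcomes the constants from [n = 133] on. The others follow
    earlier. *)
Lemma asum_checkP n : (3 <= n)%N -> asum_check asum n.
Proof.
move=> n3; have [n140|n140] := ltnP n 140; first exact: asum_check_small.
have lo := asum_ge; have up := asum_le.
rewrite /asum_check; apply/and4P; split; last apply/orP; last right.
- move: (up (3 * n - 1)%N) (lo n) (lo (n - 3)%N) (lo (n - 1)%N).
  move: (asum _) (asum _) (asum _) (asum _) => *; lia.
- move: (up (3 * n + 2)%N) (up (3 * n - 7)%N) (up (n - 1)%N) (lo n) (lo (n -
    3)%N) (lo (n - 2)%N).
  move: (asum _) (asum _) (asum _) (asum _) (asum _) (asum _) => *; lia.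
- move: (up n) (lo (3 * n + 2)%N); move: (asum _) (asum _) => *; lia.
- move: (up (3 * n - 1)%N) (up (3 * n - 4)%N) (up (3 * n - 10)%N) (up (3 * n - 7)%N)
    (lo n) (lo (n - 3)%N) (lo (n - 1)%N) (lo (n - 4)%N) (lo (n - 2)%N) (lo (n - 6)%N).
  move: (asum _) (asum _) (asum _) (asum _) (asum _) (asum _) (asum _) (asum _) (asum
      _) (asum _) => *; lia.
Qed.

(** With [g = 1 / (1 - q)], the positivity of [Z0] reduces to that of [(1 + q^3) g (a^2 - q c^2) + 2
    q a c (g - q)]. This is [a qalpha + q c qbeta]: the term [2 q g a c] is split as [3 - 1], so
    that the coefficients of both series grow at the rate of the partial sums of [a], as [2 - 1] and
    [3 - 2]. *)
Definition qalpha : fps int :=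
  locked ((1 + X ^+ 3) * (geom 1 * aser) - X * (geom 1 * cser)).
Definition qbeta : fps int :=
  locked (3%:R * (geom 1 * aser) - (1 + X ^+ 3) * (geom 1 * cser) - 2%:R * (X * aser)).

Lemma qalphaE : qalpha = (1 + X ^+ 3) * (geom 1 * aser) - X * (geom 1 * cser).
Proof. by rewrite /qalpha -lock. Qed.

Lemma qbetaE :
  qbeta = 3%:R * (geom 1 * aser) - (1 + X ^+ 3) * (geom 1 * cser) - 2%:R * (X * aser).
Proof. by rewrite /qbeta -lock. Qed.

Lemma aser_asum n : aser n.+1 = (asum n.+1)%:Z - (asum n)%:Z.
Proof. by rewrite -!asumE !coef_geom1M [X in X - _]big_ord_recr addrAC subrr add0r. Qed.

Lemma coef_qalpha n : (3 <= n)%N -> 2 * qalpha n =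
  2 * (asum n)%:Z + 2 * (asum (n - 3))%:Z + (asum (n - 1))%:Z - (asum (3 * n - 1))%:Z.
Proof.
move=> n3; rewrite qalphaE [(1 + _) * _]mulrDl mul1r !coef_fpsD coef_fpsN coef_fpsMXn
    n3.
case: n n3 => // n n3; rewrite coef_fpsMX !asumE (_ : n.+1 - 1 = n)%N; last by lia.
have -> : (3 * n.+1 - 1 = 3 * n + 2)%N by lia.
have := csumE n; move: ((geom 1 * cser) n) (asum _) (asum _) (asum _) (asum _) => *;
    lia.
Qed.

Lemma coef_qbeta n : (3 <= n)%N -> 2 * qbeta n =
  7 * (asum n)%:Z + (asum (n - 3))%:Z + 4 * (asum (n - 2))%:Z
  - (asum (3 * n + 2))%:Z - (asum (3 * n - 7))%:Z - 4 * (asum (n - 1))%:Z.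
Proof.
move=> n3; rewrite qbetaE [(1 + _) * _]mulrDl mul1r !coef_fpsD !coef_fpsN ?coef_fpsD.
rewrite !coef_fps_natM coef_fpsMXn n3 asumE.
have := csumE n; have := csumE (n - 3).
have -> : (3 * (n - 3) + 2 = 3 * n - 7)%N by lia.
case: n n3 => [|[|n]] // n3; rewrite coef_fpsMX aser_asum.
have -> : (n.+2 - 1 = n.+1)%N by lia.
have -> : (n.+2 - 2 = n)%N by lia.
move: ((geom 1 * cser) n.+2) ((geom 1 * cser) (n.+2 - 3)%N).
move: (asum _) (asum _) (asum _) (asum _) (asum _) (asum _) => *.
lia.
Qed.

Lemma asum_small : [/\ asum 0 = 1, asum 1 = 7, asum 2 = 7, asum 3 = 13 & asum 4 =
    19]%N /\
  [/\ asum 5 = 19, asum 8 = 31, asum 11 = 37 & asum 14 = 55]%N.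
Proof. by do 2?split; vm_compute. Qed.

Lemma csum_small : [/\ (geom 1 * cser) 0%N = 3, (geom 1 * cser) 1%N = 6 & (geom 1 *
    cser) 2%N = 12].
Proof.
have := csumE 0; have := csumE 1; have := csumE 2; have [[]] := asum_small.
move: asum => s s0 s1 s2 _ _ [s5 s8 _ _].
rewrite -[(3 * 2 + 2)%N]/8%N -[(3 * 1 + 2)%N]/5%N -[(3 * 0 + 2)%N]/2%N s0 s1 s2 s5 s8.
move: ((geom 1 * cser) 0%N) ((geom 1 * cser) 1%N) ((geom 1 * cser) 2%N) => a b c *;
    split; lia.
Qed.

Lemma aser0 : aser 0%N = 1.
Proof. by have := asumE 0; have [[-> _ _ _ _] _] := asum_small;
    rewrite coef_geom1M big_ord1. Qed.

Lemma aser1 : aser 1%N = 6.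
Proof. by rewrite aser_asum; have [[-> -> _ _ _] _] := asum_small. Qed.

Lemma aser_3 : aser 3%N = 6.
Proof. by rewrite aser_asum; have [[_ _ -> -> _] _] := asum_small. Qed.

Lemma cser0 : cser 0%N = 3.
Proof. by have [] := csum_small; rewrite coef_geom1M big_ord1. Qed.

Lemma qalpha_small : [/\ qalpha 0%N = 1, qalpha 1%N = 4 & qalpha 2%N = 1].
Proof.
have [c0 c1 c2] := csum_small; rewrite qalphaE [(1 + _) * _]mulrDl mul1r.
have [[s0 s1 s2 _ _] _] := asum_small.
by split; rewrite !coef_fpsD coef_fpsN coef_fpsMXn coef_fpsMX ?c0 ?c1 asumE ?s0 ?s1 ?s2.
Qed.

Lemma qbeta_small : [/\ qbeta 0%N = 0, qbeta 1%N = 13 & qbeta 2%N = - 3].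
Proof.
have [c0 c1 c2] := csum_small; rewrite qbetaE [(1 + _) * _]mulrDl mul1r.
have [[s0 s1 s2 _ _] _] := asum_small.
by split; rewrite !coef_fpsD !coef_fpsN coef_fpsD !coef_fps_natM coef_fpsMXn coef_fpsMX
    ?c0 ?c1 ?c2 asumE ?aser0 ?aser1 ?s0 ?s1 ?s2.
Qed.

Lemma qalpha_ge0 : fps_ge0 qalpha.
Proof.
move=> n; have [a0 a1 a2] := qalpha_small.
case: n => [|[|[|n]]]; rewrite ?a0 ?a1 ?a2 //.
have := @coef_qalpha n.+3 isT; have /and4P[] := @asum_checkP n.+3 isT.
move: (asum _) (asum _) (asum _) (asum _) (qalpha _) => *; lia.
Qed.

Lemma qbeta_ge0 : fps_ge0 (qbeta + 3%:R * X ^+ 2).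
Proof.
move=> n; have [b0 b1 b2] := qbeta_small; rewrite coef_fpsD coef_fps_natM coef_fpsXn.
case: n => [|[|[|n]]]; rewrite ?b0 ?b1 ?b2 // mulr0 addr0.
have := @coef_qbeta n.+3 isT; have /and4P[_ + _ _] := @asum_checkP n.+3 isT.
move: (asum _) (asum _) (asum _) (asum _) (asum _) (asum _) (qbeta _) => *; lia.
Qed.

Lemma cser_le_csum n : cser n <= (geom 1 * cser) n.
Proof.
rewrite coef_geom1M big_ord_recr /= lerDr sumr_ge0 // => i _; exact: cser_ge0.
Qed.

(** The polynomial is the beginning of [a], and the subtracted series is the loss in [q c qbeta]
    from the coefficient -3. Bounding [c(n)] by its partial sum is crude, yet it costs only 3 times
    the growth rate against [1 + 6 + 6]. *)
Lemma qalpha_dominates n :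
  0 < ((1 + 6%:R * X + 6%:R * X ^+ 3) * qalpha - 3%:R * (X ^+ 3 * cser)) n.
Proof.
have [a0 a1 a2] := qalpha_small.
have -> : (1 + 6%:R * X + 6%:R * X ^+ 3) * qalpha - 3%:R * (X ^+ 3 * cser) =
  qalpha + 6%:R * (X * qalpha) + 6%:R * (X ^+ 3 * qalpha) - 3%:R * (X ^+ 3 * cser).
  by move: qalpha cser => f g; ring.
rewrite !coef_fpsD !coef_fpsN !coef_fps_natM !coef_fpsMXn coef_fpsMX.
case: n => [|[|[|n]]].
- by rewrite a0.
- by rewrite a1 a0.
- by rewrite a2 a1.
rewrite (_ : (3 <= n.+3)%N = true) //.
have -> : (n.+3 - 3 = n)%N by lia.
have := cser_le_csum n; have := csumE n.
case: n => [|[|[|n]]].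
- have := @coef_qalpha 3 isT; have [-> _ _] := csum_small; rewrite a0 a2;
    have [[]] := asum_small.
  move: asum => s s0 s1 s2 s3 s4 [s5 s8 _ _].
  rewrite -[(3 - 3)%N]/0%N -[(3 - 1)%N]/2%N -[(3 * 3 - 1)%N]/8%N s0 s2 s3 s8.
  by move: (cser _) (qalpha _) => *; lia.
- have := @coef_qalpha 3 isT; have := @coef_qalpha 4 isT; have [_ -> _] := csum_small.
  rewrite a1; have [[]] := asum_small; move: asum => s s0 s1 s2 s3 s4 [s5 s8 s11 _].
  rewrite -[(3 - 3)%N]/0%N -[(3 - 1)%N]/2%N -[(3 * 3 - 1)%N]/8%N.
  rewrite -[(4 - 3)%N]/1%N -[(4 - 1)%N]/3%N -[(3 * 4 - 1)%N]/11%N s0 s1 s2 s3 s4 s8 s11.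
  by move: (cser _) (qalpha 3%N) (qalpha 4%N) => *; lia.
- have := @coef_qalpha 4 isT; have := @coef_qalpha 5 isT; have [_ _ ->] := csum_small.
  rewrite a2; have [[]] := asum_small; move: asum => s s0 s1 s2 s3 s4 [s5 s8 s11 s14].
  rewrite -[(4 - 3)%N]/1%N -[(4 - 1)%N]/3%N -[(3 * 4 - 1)%N]/11%N.
  rewrite -[(5 - 3)%N]/2%N -[(5 - 1)%N]/4%N -[(3 * 5 -
      1)%N]/14%N s1 s2 s3 s4 s5 s11 s14.
  by move: (cser _) (qalpha 4%N) (qalpha 5%N) => *; lia.
have := @coef_qalpha n.+3 isT; have := @coef_qalpha n.+1.+4 isT;
    have := @coef_qalpha n.+2.+4 isT.
have /and4P[_ _ _] := @asum_checkP n.+2.+4 isT; rewrite orFb.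
have -> : (n.+2.+4 - 3 = n.+3)%N by lia.
have -> : (n.+2.+4 - 1 = n.+1.+4)%N by lia.
have -> : (n.+2.+4 - 4 = n.+2)%N by lia.
have -> : (n.+2.+4 - 2 = n.+4)%N by lia.
have -> : (n.+2.+4 - 6 = n)%N by lia.
have -> : (n.+1.+4 - 3 = n.+2)%N by lia.
have -> : (n.+1.+4 - 1 = n.+4)%N by lia.
have -> : (n.+3 - 3 = n)%N by lia.
have -> : (n.+3 - 1 = n.+2)%N by lia.
have -> : (3 * n.+2.+4 - 4 = 3 * n.+1.+4 - 1)%N by lia.
have -> : (3 * n.+2.+4 - 10 = 3 * n.+3 - 1)%N by lia.
have -> : (3 * n.+2.+4 - 7 = 3 * n.+3 + 2)%N by lia.
move: ((geom 1 * cser) _) (cser _) (qalpha _) (qalpha _) (qalpha _).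
move: (asum (_ - _)) (asum (_ - _)) (asum (_ - _)) (asum (_ + _)).
move: (asum _) (asum _) (asum _) (asum _) (asum _) (asum _) => *; lia.
Qed.

(** * Signs *)

Definition fps_gt0 (f : fps int) := forall n, 0 < f n.

Lemma fps_gt0D f g : fps_gt0 f -> fps_ge0 g -> fps_gt0 (f + g).
Proof. by move=> f0 g0 n; rewrite coef_fpsD ltr_wpDr. Qed.

Lemma fps_gt0M f g : fps_ge0 f -> 0 < f 0%N -> fps_gt0 g -> fps_gt0 (f * g).
Proof.
move=> f0 f00 g0 n; rewrite coef_fpsM big_ord_recl ltr_wpDr //.
  by rewrite sumr_ge0 // => i _; rewrite mulr_ge0 // ltW.
by rewrite mulr_gt0.
Qed.

Lemma fps_gt0_geom1 : fps_gt0 (geom 1).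
Proof. by move=> n; rewrite coef_fps_geom // dvd1n. Qed.

Lemma fps_gt0_ge0 f : fps_gt0 f -> fps_ge0 f.
Proof. by move=> f0 n; rewrite ltW. Qed.

Lemma qinv_coef0 i : (0 < i)%N -> qinv i 0%N = 1.
Proof.
by move=> i0; rewrite (@eqmod_qinv i 1 i0 0%N) // big_ord1 coef_fps_geom ?dvdn0
    ?addn_gt0 ?i0.
Qed.

Lemma gt0_qinv1 : fps_gt0 (qinv 1).
Proof.
rewrite qinv_recl // mulrC; apply: fps_gt0M fps_gt0_geom1; first exact: qinv_ge0.
by rewrite qinv_coef0.
Qed.

Ltac series_ge0 := repeat first
  [ exact: aser_ge0 | exact: cser_ge0 | exact: fps_ge0_X | exact: fps_ge0_1 | exact:
      fps_ge0_Xn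
  | exact: fps_ge0_nat | (apply: qinv_ge0; done) | (apply: fps_ge0_geom; done)
  | apply: fps_ge0D | apply: fps_ge0M | apply: fps_ge0_exp ].

Ltac coef0 := rewrite !(expr2, coef_fpsM0, coef_fps_natM, aser0, cser0, coef_fps1,
    qinv_coef0).

Lemma e1invE : e1inv = qinv 2 * qinv 3 * qinv 4 * qinv 5 * qinv 6 * qinv 7 * qinv 8 *
    qinv 9 * qinv 1.
Proof.
apply: (mulrI (E_unit (isT : 0 < 1)%N)); rewrite e1invK euler9.
have q i : (0 < i)%N -> qpoch int 9 i * qinv i = 1 by exact: qinvK.
move: (q 1%N isT) (q 2%N isT) (q 3%N isT) (q 4%N isT) (q 5%N isT) (q 6%N isT) (q 7%N
    isT) (q 8%N isT) (q 9%N isT).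
move: (qpoch int 9 1) (qpoch int 9 2) (qpoch int 9 3) (qpoch int 9 4) (qpoch int 9 5)
  (qpoch int 9 6) (qpoch int 9 7) (qpoch int 9 8) (qpoch int 9 9) =>
      p1 p2 p3 p4 p5 p6 p7 p8 p9.
move: (qinv 1) (qinv 2) (qinv 3) (qinv 4) (qinv 5) (qinv 6) (qinv 7) (qinv 8) (qinv 9)
  => q1 q2 q3 q4 q5 q6 q7 q8 q9 h1 h2 h3 h4 h5 h6 h7 h8 h9.
transitivity ((p1 * q1) * (p2 * q2) * (p3 * q3) * (p4 * q4) * (p5 * q5) * (p6 * q6) *
    (p7 * q7) * (p8 * q8) * (p9 * q9)).
  by rewrite h1 h2 h3 h4 h5 h6 h7 h8 h9 !mulr1.
by ring.
Qed.

Lemma e1inv_ge0 : fps_ge0 e1inv.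
Proof. by rewrite e1invE; series_ge0. Qed.

Lemma e1inv_coef0 : e1inv 0%N = 1.
Proof. by rewrite e1invE; coef0. Qed.

Lemma gt0_e1inv2 : fps_gt0 (e1inv ^+ 2).
Proof.
have e0 := e1inv_ge0; have e00 := e1inv_coef0; rewrite expr2.
apply: fps_gt0M => //; rewrite ?e00 // e1invE; apply: fps_gt0M gt0_qinv1;
    first by series_ge0.
by coef0.
Qed.

Lemma gt0_qA : fps_gt0 qA.
Proof.
rewrite (_ : qA = qinv 8 * (qinv 2 * qinv 7) * (qinv 3 * qinv 6) * qinv 1);
    last by rewrite /qA; ring.
by apply: fps_gt0M gt0_qinv1; [series_ge0 | coef0].
Qed.

Lemma gt0_qB : fps_gt0 qB.
Proof.
rewrite (_ : qB = qinv 8 * (qinv 4 * qinv 5) * (qinv 3 * qinv 6) * qinv 1);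
    last by rewrite /qB; ring.
by apply: fps_gt0M gt0_qinv1; [series_ge0 | coef0].
Qed.

Lemma qD_ge0 : fps_ge0 qD.
Proof. by rewrite /qD; series_ge0. Qed.

Lemma gt0_qZ1 : fps_gt0 qZ1.
Proof.
rewrite /qZ1 -addrA; apply: fps_gt0D.
  by apply: fps_gt0M gt0_qB; [series_ge0 | coef0].
by apply: fps_ge0D; apply: fps_ge0M; try exact: qD_ge0; try exact:
    (fps_gt0_ge0 gt0_qA); series_ge0.
Qed.

Lemma csum_ge : fps_ge0 (geom 1 * (2%:R * cser - aser)).
Proof.
move=> n; rewrite mulrBr mulrCA coef_fpsD coef_fpsN coef_fps_natM asumE.
have := csumE n; have [n3|n3] := leqP 3 n.
  have /and4P[_ _ + _] := asum_checkP n3.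
  by move: (asum _) (asum _) ((geom 1 * cser) _) => *; lia.
have [c0 c1 c2] := csum_small; have [[s0 s1 s2 _ _] _] := asum_small.
by case: n n3 => [|[|[|]]] // _; rewrite ?c0 ?c1 ?c2 ?s0 ?s1 ?s2.
Qed.

(** [Z2 = c^2 A + a (2 c - a) B + a^2 (B - D)], and the factor [1 / (1 - q)] of [B] turns [2 c - a]
    into its partial sums. *)
Lemma gt0_qZ2 : fps_gt0 qZ2.
Proof.
have -> : qZ2 = cser ^+ 2 * qA + (aser * ((geom 1 * (2%:R * cser - aser)) *
   (qinv 10 * qinv 8 * (qinv 4 * qinv 5) * (qinv 3 * qinv 6))) + aser ^+ 2 * (qB - qD)).
  rewrite /qZ2; have -> : qB = geom 1 * (qinv 10 * qinv 8 * (qinv 4 * qinv 5) *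
      (qinv 3 * qinv 6)).
    by rewrite /qB (@qinv_recl 1) //; ring.
  by move: (qinv 10 * _ * _ * _) (geom 1) qA qD aser cser => *; ring.
apply: fps_gt0D; first by apply: fps_gt0M gt0_qA; [series_ge0 | coef0].
apply: fps_ge0D; last by apply: fps_ge0M; [series_ge0 | exact: qB_ge_qD].
by apply: fps_ge0M; [series_ge0 | apply: fps_ge0M; [exact: csum_ge | series_ge0]].
Qed.

(* [qbeta] has one negative coefficient, [- 3] at [X ^ 2]; by [qalpha_dominates] the
   first term compensates for it. *)
Definition qW : fps int := aser * qalpha + X * cser * qbeta.

Lemma gt0_qW : fps_gt0 qW.
Proof.
have -> : qW = ((1 + 6%:R * X + 6%:R * X ^+ 3) * qalpha - 3%:R * (X ^+ 3 * cser))
  + ((aser - (1 + 6%:R * X + 6%:R * X ^+ 3)) * qalpha + X * cser * (qbeta + 3%:R *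
      X ^+ 2)).
  by rewrite /qW; move: aser cser qalpha qbeta => a c al be; ring.
apply: fps_gt0D; first exact: qalpha_dominates.
apply: fps_ge0D; apply: fps_ge0M; try exact: qalpha_ge0; try exact: qbeta_ge0;
    last by series_ge0.
move=> n; rewrite coef_fpsD coef_fpsN !coef_fpsD !coef_fps_natM !coef_fpsXn coef_fps1.
rewrite -[X]expr1 coef_fpsXn.
case: n => [|[|[|[|n]]]]; rewrite ?aser0 ?aser1 ?aser_3 ?subr0 //; exact: aser_ge0.
Qed.

Definition qK := geom 6 * (qinv 11 * qinv 7 * qinv 12 * qinv 6 * (qinv 4 * qinv 5)).

(** [D] has no factor [1 / (1 - q)] of its own. One is extracted from [1 / ((1 - q^2) (1 - q^3))] by
    [1 - q^6 = (1 - q^3) (1 + q) (1 - q + q^2)], at the price of the correction [- q]. *)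
Lemma qD_qK : qD = qK * (geom 1 - X) /\ (1 + X) * qD = qK * ((1 + X ^+ 3) * geom 1).
Proof.
have g k : (0 < k)%N -> (1 - X ^+ k) * geom k = 1 by exact: fps_geomK.
have E23 : geom 2 * geom 3 = geom 6 * (geom 1 - X).
  have u : (1 - X ^+ 1) * (1 - X ^+ 6) * ((1 - X ^+ 2) * (1 - X ^+ 3)) \is a GRing.unit.
    by rewrite !unitrM !fps_unit1BXn.
  apply: (mulrI u); move: (g 1%N isT) (g 2%N isT) (g 3%N isT) (g 6%N isT).
  move: (geom 1) (geom 2) (geom 3) (geom 6) => g1 g2 g3 g6 h1 h2 h3 h6.
  transitivity ((1 - X ^+ 1) * (1 - X ^+ 6) * (((1 - X ^+ 2) * g2) * ((1 - X ^+ 3) *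
      g3))); first by ring.
  rewrite h2 h3.
  transitivity (((1 - X ^+ 6) * g6) * (((1 - X ^+ 1) * g1) - X * (1 - X ^+ 1)) * ((1 -
      X ^+ 2) * (1 - X ^+ 3))); last by ring.
  by rewrite h1 h6; ring.
have g2 : (1 + X) * geom 2 = geom 1.
  apply: (mulrI (fps_unit1BXn int (isT : 0 < 1)%N)); rewrite g //.
  by transitivity ((1 - X ^+ 2) * geom 2); [ring | rewrite g].
have g3 : geom 3 = (1 + X ^+ 3) * geom 6.
  apply: (mulrI (fps_unit1BXn int (isT : 0 < 3)%N)); rewrite g //.
  by transitivity ((1 - X ^+ 6) * geom 6); [rewrite g | ring].
have DE : qD = geom 2 * geom 3 * (qinv 11 * qinv 7 * qinv 12 * qinv 6 * (qinv 4 *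
    qinv 5)).
  by rewrite /qD (@qinv_recl 2) // (@qinv_recl 3) //; ring.
rewrite DE /qK; split; first by rewrite E23; ring.
transitivity (((1 + X) * geom 2) * geom 3 * (qinv 11 * qinv 7 * qinv 12 * qinv 6 *
    (qinv 4 * qinv 5))).
  by move: (qinv 11 * _ * _ * _ * _) (geom 2) (geom 3) => *; ring.
by rewrite g2 g3; move: (qinv 11 * _ * _ * _ * _) (geom 1) (geom 6) => *; ring.
Qed.

(** Both [A], from below, and [B], from above, are replaced by [(1 + q) D]; what remains is a
    multiple of [qK] by [qD_qK]. *)
Lemma gt0_qZ0 : fps_gt0 qZ0.
Proof.
have [D1 D2] := qD_qK.
have -> : qZ0 = qK * qW + (aser ^+ 2 * (qA - (1 + X) * qD) + X * cser ^+ 2 * ((1 + X) *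
    qD - qB)).
  transitivity (aser ^+ 2 * (qA - (1 + X) * qD) + X * cser ^+ 2 * ((1 + X) * qD - qB)
    + ((aser ^+ 2 - X * cser ^+ 2) * ((1 + X) * qD) + 2%:R * X * aser * cser * qD)).
    by rewrite /qZ0; move: aser cser qA qB qD => *; ring.
  rewrite addrC; congr (_ + _); rewrite D2 [in X in _ + X]D1 /qW qalphaE qbetaE.
  by move: aser cser qK (geom 1) => *; ring.
apply: fps_gt0D.
  by apply: fps_gt0M gt0_qW; rewrite /qK; [series_ge0 | coef0; rewrite ?coef_fps_geom].
by apply: fps_ge0D; apply: fps_ge0M; try exact: qA_ge_qD; try exact: qD_ge_qB;
    series_ge0.
Qed.

Lemma gt0_u1 : fps_gt0 (3%:R * aser ^+ 2 * cser * e1inv ^+ 2).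
Proof. by apply: fps_gt0M gt0_e1inv2; [series_ge0 | coef0]. Qed.

Lemma gt0_u2 : fps_gt0 (3%:R * aser * cser ^+ 2 * e1inv ^+ 2).
Proof. by apply: fps_gt0M gt0_e1inv2; [series_ge0 | coef0]. Qed.

Lemma sgz_coef n : s_1_9_3_m5 n = if (n %% 9 \in [:: 1; 3; 4; 7])%N then -1 else 1.
Proof.
rewrite /s_1_9_3_m5 /C_1_9_3_m5 eta_trisection.
have n3 := divn_eq n 3; have r3 : (n %% 3 < 3)%N by rewrite ltn_mod.
have [c0 c1 c2] := coef_trisection ((aser ^+ 3 - X * cser ^+ 3) * e1inv ^+ 2)
  (- (3%:R * aser ^+ 2 * cser * e1inv ^+ 2)) (3%:R * aser * cser ^+ 2 *
      e1inv ^+ 2) (n %/ 3).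
move: n3 r3 c0 c1 c2; move: (n %/ 3)%N (n %% 3)%N => k r -> {n}; rewrite [(k *
    3)%N]mulnC.
case: r => [|[|[|//]]] _ c0 c1 c2.
- rewrite addn0 c0 trisection_Z.
  have k3 := divn_eq k 3; have r3 : (k %% 3 < 3)%N by rewrite ltn_mod.
  have [d0 d1 d2] := coef_trisection qZ0 (- qZ1) qZ2 (k %/ 3).
  move: k3 r3 d0 d1 d2; move: (k %/ 3)%N (k %% 3)%N => l r -> {k c0 c1 c2};
      rewrite [(l * 3)%N]mulnC.
  case: r => [|[|[|//]]] _ d0 d1 d2.
  + rewrite addn0 d0 gtr0_sgz ?gt0_qZ0 //.
    by rewrite (_ : (_ \in _) = false) // !inE; lia.
  + rewrite addn1 d1 coef_fpsN sgzN gtr0_sgz ?gt0_qZ1 //.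
    by rewrite (_ : (_ \in _) = true) // !inE; lia.
  + rewrite addn2 d2 gtr0_sgz ?gt0_qZ2 //.
    by rewrite (_ : (_ \in _) = false) // !inE; lia.
- rewrite addn1 c1 coef_fpsN sgzN gtr0_sgz ?gt0_u1 //.
  rewrite (_ : (_ \in _) = true) // !inE; lia.
- rewrite addn2 c2 gtr0_sgz ?gt0_u2 //.
  rewrite (_ : (_ \in _) = false) // !inE; lia.
Qed.

Theorem theorem1p5 (n : nat) :
  ((n %% 9)%N \in [:: 0; 2; 5; 6; 8]%N -> s_1_9_3_m5 n = 1) /\
  ((n %% 9)%N \in [:: 1; 3; 4; 7]%N -> s_1_9_3_m5 n = - 1).
Proof.
rewrite sgz_coef; split=> [|-> //].
by case: ifP => // /[swap]; move: (n %% 9)%N => r; rewrite !inE => /orP[/eqP->|/or4P[] /eqP->].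
Qed.
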